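(* Let $\mathcal{P}$ be a universal, branching-parsimonious elimination procedure for the theory of algebraically closed fields of characteristic zero with constants $0,1$, associated with an output data structure which allows the holomorphic encoding of polynomials, and let $\mathcal{T}$ be a monotone sequential time complexity measure for $\mathcal{P}$. Suppose that $\mathcal{P}$ accepts as inputs prenex existential formulas whose polynomial terms are given in arithmetic circuit (or alternatively in sparse) representation. Suppose that $\mathcal{P}$ and $\mathcal{T}$ satisfy the following conditions. (1) Let $\Phi$ be a prenex existential formula of the elementary language $\mathcal{L}$ of algebraically closed fields of characteristic zero with constants $0,1$, whose polynomial terms are encoded by the input data structure of $\mathcal{P}$. Then $\mathcal{P}$ produces from $\Phi$ a quantifier-free formula $\Psi$, equivalent to $\Phi$, whose polynomial terms are (holomorphically) encoded by the output data structure of $\mathcal{P}$, and the length satisfies $|\Psi|\le\mathcal{T}(|\Phi|)$. (2) Let $\Xi\in\mathcal{L}$ be a quantifier-free formula whose polynomial terms are encoded by the output data structure of $\mathcal{P}$. Then $\mathcal{P}$ produces from $\Xi$ a system of polynomial equations $\mathcal{F}$, encoded by the output data structure of $\mathcal{P}$, which defines the Zariski closure of the $\mathbb{Q}$-constructible set defined by $\Xi$, and $|\mathcal{F}|\le\mathcal{T}(|\Xi|)$. (3) Let $\mathcal{B}$ be a system of polynomials encoded by the output data structure of $\mathcal{P}$ which represents an algebraic family of univariate polynomials for which a generically squarefree parametric greatest common divisor $\widehat{h}$ exists. Then $\mathcal{P}$ produces from $\mathcal{B}$ an (essentially division-free) algorithm which computes $\widehat{h}$ for any admissible input instance of $\mathcal{B}$,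 where $\widehat{h}$ is represented by a polynomial $H$ encoded by the output data structure of $\mathcal{P}$, and the size satisfies $|H|\le\mathcal{T}(|\mathcal{B}|)$. Then $\mathcal{T}$ is not a polynomial function.
   Context: Here $k=\mathbb{Q}$, $\overline{k}=\mathbb{C}$, $\mathbb{A}^n=\mathbb{C}^n$. A $\mathbb{Q}$-constructible (or $\mathbb{Q}$-definable) set is a finite boolean combination of zero sets of polynomials over $\mathbb{Q}$. Data structures and encodings. A data structure of size $m$ is a $\mathbb{Q}$-constructible subset $\mathcal{D}^*\subset\mathbb{A}^m$; a holomorphic encoding of a class $\mathcal{O}^*$ of polynomials (identified with a subset of an affine space via coefficients) is a surjective map $\omega^*:\mathcal{D}^*\to\mathcal{O}^*$ which is the restriction of a polynomial map with rational coefficients. The size of an encoded object is the dimension $m$ of the ambient space of its codes. The procedure $\mathcal{P}$ comes with an input data structure (arithmetic circuits or sparse encoding of polynomials, integers in bit representation) and an output data structure holomorphically encoding polynomials. $|\cdot|$ denotes the length/size of formulas, systems and polynomials with respect to these data structures. An elimination algorithm is universal if it solves, for appropriate input and output data structures, any standard elimination problem on arbitrary inputs consisting of boolean combinations of parameter dependent polynomial equations. It is branching-parsimonious if it avoids branchings for the solution of suitable instances of the following problems: computing the elimination polynomial of a parametric zero-dimensional elimination problem, and passing from an encoding of an object class to an encoding of its topological closure. The input and output formulas in (1) may be represented by algorithms with branchings; the outputs in (2) and (3) are required to represent branching-free evaluation procedures. Arithmetic circuits. The polynomial terms are represented by directed acyclic graphs with input nodes (variables), scalars, and internal nodes labelled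 by arithmetic operations. Algebraic families and parametric gcd. Let $B_1,\ldots,B_s\in\mathbb{Q}[U_1,\ldots,U_r,Y]$ be nonzero with $V:=\{B_1=0,\ldots,B_s=0\}\subset\mathbb{A}^r\times\mathbb{A}^1$ nonempty, let $\pi:V\to\mathbb{A}^r$ be the canonical projection, and suppose that the Zariski closure $S$ of $\pi(V)$ is irreducible. Let $b_1,\ldots,b_s\in\mathbb{Q}[S][Y]$ be the induced polynomials, not all zero; after renumbering, $b_1,\ldots,b_q$ are the nonzero ones; they form an algebraic family of univariate polynomials represented by $B_1,\ldots,B_q$. Let $h\in\mathbb{Q}(S)[Y]$ be their monic greatest common divisor. One says that $h$ is the parametric greatest common divisor if $\deg_Y h\ge1$ and for any $u\in S$ and any place $\varphi:\mathbb{C}(S)\to\mathbb{C}\cup\{\infty\}$ whose valuation ring contains the local ring of $S$ at $u$, the values under $\varphi$ of the coefficients of $h$ are finite and uniquely determined by $u$; the resulting monic polynomial in $\mathbb{C}[Y]$ is denoted $h(u)(Y)$. A monic squarefree polynomial $\widehat{h}\in\mathbb{Q}(S)[Y]$ with the same zeroes as $h$ in an algebraic closure of $\mathbb{Q}(S)$ is the generically squarefree parametric greatest common divisor of the family if $\widehat{h}$ satisfies the same requirements as those just imposed on $h$; in this case one says that it exists. A polynomial $H\in\mathbb{Q}(U_1,\ldots,U_r)[Y]$ with $\deg_Y H=\deg_Y\widehat{h}$ represents $\widehat{h}$ if its coefficients induce well-defined rational functions of $S$ equal to the coefficients of $\widehat{h}$. Algorithm computing $\widehat{h}$ for any admissible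 input instance: rational functions $\theta_1,\ldots,\theta_m\in\mathbb{Q}(S)$ (where $m=|H|$ is the size of the output data structure $\mathcal{D}^*\subset\mathbb{A}^m$ used) such that $\widehat{h}\in\mathbb{Q}[\theta_1,\ldots,\theta_m][Y]$, such that for any $u\in S$ and any place $\varphi$ of $\mathbb{C}(S)$ whose valuation ring contains the local ring of $S$ at $u$ the values $\varphi(\theta_1),\ldots,\varphi(\theta_m)$ are finite and uniquely determined by $u$, and such that the point $\theta(u)$ of these values is a code in $\mathcal{D}^*$ of the polynomial $\widehat{h}(u)(Y)$ under the holomorphic encoding of the output data structure. *)

(* Defs.v *)
From HB Require Import structures.
From mathcomp Require Import all_boot all_order all_algebra.
From mathcomp Require Import generic_quotient ring_quotient fraction.
From mathcomp Require Import boolp classical_sets reals complex.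
From mathcomp Require Import mpoly.

Set Implicit Arguments.
Unset Strict Implicit.
Unset Printing Implicit Defensive.

Import Order.TTheory GRing.Theory Num.Theory.

Local Open Scope classical_set_scope.
Local Open Scope ring_scope.

(* C is the algebraically closed ground field of characteristic 0; it is
   instantiated by the complex numbers R[i]. *)
Definition aff (C : Type) (n : nat) : Type := 'I_n -> C.

Inductive qform (A : Type) : Type :=
| QAtom of A
| QNot of qform A
| QAnd of qform A & qform A
| QOr of qform A & qform A.

(* [zero a] is the solution set of the equation "a = 0". *)
Fixpoint qset (A X : Type) (zero : A -> set X) (f : qform A) : set X :=
  match f with
  | QAtom a => zero a
  | QNot g => ~` qset zero g
  | QAnd g h => qset zero g `&` qset zero h
  | QOr g h => qset zero g `|` qset zero h
  end.

Fixpoint qall (A : Type) (P : A -> Prop) (f : qform A) : Prop :=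
  match f with
  | QAtom a => P a
  | QNot g => qall P g
  | QAnd g h | QOr g h => qall P g /\ qall P h
  end.

Fixpoint qlength (A : Type) (size_of : A -> nat) (f : qform A) : nat :=
  match f with
  | QAtom a => (size_of a).+1
  | QNot g => (qlength size_of g).+1
  | QAnd g h | QOr g h => (qlength size_of g + qlength size_of h).+1
  end.

Definition bitsize (z : int) : nat := (trunc_log 2 `|z|%N).+2.

(* A gate whose operands are chosen among k earlier nodes. *)
Inductive gate (n k : nat) : Type :=
| GVar of 'I_n
| GConst of int
| GAdd of 'I_k & 'I_k
| GSub of 'I_k & 'I_k
| GMul of 'I_k & 'I_k.

(* Directed acyclic graphs with k nodes, in topological order. *)
Inductive dag (n : nat) : nat -> Type :=
| DagNil : dag n 0
| DagSnoc k : dag n k -> gate n k -> dag n k.+1.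

Definition gate_poly n k (v : 'I_k -> {mpoly int[n]}) (g : gate n k) :
    {mpoly int[n]} :=
  match g with
  | GVar i => 'X_i
  | GConst c => c%:MP
  | GAdd i j => v i + v j
  | GSub i j => v i - v j
  | GMul i j => v i * v j
  end.

Fixpoint dag_poly n k (c : dag n k) : 'I_k -> {mpoly int[n]} :=
  match c with
  | DagNil => fun=> 0
  | DagSnoc _ c g => fun i =>
      if unlift ord_max i is Some j then dag_poly c j
      else gate_poly (dag_poly c) g
  end.

Definition gate_size n k (g : gate n k) : nat :=
  if g is GConst c then (bitsize c).+1 else 1.

Fixpoint dag_size n k (c : dag n k) : nat :=
  match c with
  | DagNil => 0
  | DagSnoc _ c g => dag_size c + gate_size g
  end.

(* The output node is the last one. *)
Record circuit (n : nat) : Type := Circuit {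
  circuit_len : nat;
  circuit_dag : dag n circuit_len.+1
}.

Definition sparse (n : nat) : Type := seq (int * 'X_{1..n}).

Definition sparse_size n (s : sparse n) : nat :=
  (\sum_(t <- s) (bitsize t.1 + \sum_(i < n) bitsize (t.2 i)%:Z))%N.

Variant input_representation : Set := ArithmeticCircuit | SparseEncoding.

Definition input_term (rep : input_representation) (n : nat) : Type :=
  match rep with
  | ArithmeticCircuit => circuit n
  | SparseEncoding => sparse n
  end.

Definition input_poly rep n : input_term rep n -> {mpoly int[n]} :=
  match rep with
  | ArithmeticCircuit => fun c => dag_poly (circuit_dag c) ord_max
  | SparseEncoding => fun s => \sum_(t <- s) t.1 *: 'X_[t.2]
  end.

Definition input_size rep n : input_term rep n -> nat :=
  match rep with
  | ArithmeticCircuit => fun c => dag_size (circuit_dag c)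
  | SparseEncoding => @sparse_size n
  end.

(* n free variables, followed by the existentially quantified ones. *)
Record ex_formula (rep : input_representation) (n : nat) : Type := ExFormula {
  ex_bound : nat;
  ex_matrix : qform (input_term rep (n + ex_bound))
}.

Definition ex_length rep n (Phi : ex_formula rep n) : nat :=
  (n + ex_bound Phi + qlength (@input_size rep _) (ex_matrix Phi))%N.

Definition join_point (C : Type) n p (x : aff C n) (w : aff C p) : aff C (n + p) :=
  fun i => match split i with inl j => x j | inr j => w j end.

Definition ex_set (C : numClosedFieldType) rep n (Phi : ex_formula rep n) : set (aff C n) :=
  [set x | exists w : aff C (ex_bound Phi),
     qset (fun t => [set y | mmap intr y (input_poly t) = 0])
       (ex_matrix Phi) (join_point x w)].

Arguments ex_set C [rep n] Phi _.

Section Encodings.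

Variable C : numClosedFieldType.

Definition constructible m (A : set (aff C m)) : Prop :=
  exists f : qform {mpoly rat[m]},
    A = qset (fun p => [set x | mmap ratr x p = 0]) f.

(* A holomorphic encoding of a class of polynomials in n variables.  The
   coefficients of [enc_map] are rational polynomials in the code; the encoded
   class is by definition the image of [enc_dom] under [decode]. *)
Record encoding (n : nat) : Type := Encoding {
  enc_size : nat;
  enc_dom : set (aff C enc_size);
  enc_constructible : constructible enc_dom;
  enc_map : {mpoly {mpoly rat[enc_size]}[n]}
}.

Definition decode n (e : encoding n) (z : aff C (enc_size e)) : {mpoly C[n]} :=
  map_mpoly (mmap ratr z) (enc_map e).

(* For every number of variables, an arbitrary family of encodings. *)
Record output_structure : Type := OutputStructure {
  os_index : nat -> Type;
  os_encoding : forall n, os_index n -> encoding n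
}.

Variable D : output_structure.

(* A polynomial over Q, given by a code. *)
Record encoded (n : nat) : Type := Encoded {
  en_index : os_index D n;
  en_code : aff C (enc_size (os_encoding en_index));
  en_dom : enc_dom en_code;
  en_poly : {mpoly rat[n]};
  en_polyE : decode en_code = map_mpoly ratr en_poly
}.

Definition encoded_size n (f : encoded n) : nat :=
  enc_size (os_encoding (en_index f)).

Definition encoded_zero n (f : encoded n) : set (aff C n) :=
  [set x | mmap ratr x (en_poly f) = 0].

(* Quantifier-free formulas of the language with constants 0 and 1: the
   polynomial terms have integer coefficients. *)
Record out_formula (n : nat) : Type := OutFormula {
  of_form : qform (encoded n);
  of_integral : qall (fun f => en_poly f \is a mpolyOver n Num.int) of_form
}.

Definition out_set n (Psi : out_formula n) : set (aff C n) :=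
  qset (@encoded_zero n) (of_form Psi).

Definition out_length n (Psi : out_formula n) : nat :=
  (n + qlength (@encoded_size n) (of_form Psi))%N.

Definition system (n : nat) : Type := seq (encoded n).

Definition system_polys n (F : system n) : seq {mpoly rat[n]} :=
  map (@en_poly n) F.

Definition system_length n (F : system n) : nat :=
  (n + \sum_(f <- F) (encoded_size f).+1)%N.

End Encodings.

Section Zariski.

Variables (C : numClosedFieldType) (n : nat).

Definition zeros (I : set {mpoly C[n]}) : set (aff C n) :=
  [set x | forall p, I p -> p.@[x] = 0].

Definition zclosed (A : set (aff C n)) : Prop := exists I, A = zeros I.

Definition zclosure (A : set (aff C n)) : set (aff C n) :=
  \bigcap_(B in [set B | zclosed B /\ A `<=` B]) B.

Definition zirreducible (A : set (aff C n)) : Prop :=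
  A !=set0 /\
  forall B B', zclosed B -> zclosed B' -> A `<=` B `|` B' ->
    A `<=` B \/ A `<=` B'.

End Zariski.

Definition system_set (C : numClosedFieldType) n (Bs : seq {mpoly rat[n]}) :
    set (aff C n) :=
  [set x | forall p, p \in Bs -> mmap ratr x p = 0].

Arguments system_set C [n] Bs _.

Record irrset (C : numClosedFieldType) (n : nat) : Type := IrrSet {
  irr_set :> set (aff C n);
  irr_irreducible : zirreducible irr_set
}.

Section FunctionField.

Variables (C : numClosedFieldType) (n : nat) (S : irrset C n).

Definition vanishing : {mpoly C[n]} -> bool :=
  fun p => `[< forall x, irr_set S x -> p.@[x] = 0 >].

Lemma vanishing_idealr : idealr_closed vanishing.
Proof.
split.
- by apply/asboolP => x _; rewrite meval0.
- apply/negP => /asboolP v1; have [[x Sx] _] := irr_irreducible S.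
  by have /eqP := v1 x Sx; rewrite meval1 oner_eq0.
- move=> a u v /asboolP u0 /asboolP v0; apply/asboolP => x Sx.
  by rewrite mevalD mevalM u0 // v0 // mulr0 addr0.
Qed.

HB.instance Definition _ := isIdealr.Build _ vanishing vanishing_idealr.

Lemma vanishing_prime : prime_idealr_closed vanishing.
Proof.
move=> p q /asboolP pq0; have [_ irrS] := irr_irreducible S.
have zc r : zclosed (zeros [set r : {mpoly C[n]}]) by eexists.
have cov : irr_set S `<=` zeros [set p] `|` zeros [set q].
  move=> x Sx; have /eqP := pq0 x Sx; rewrite mevalM mulf_eq0.
  by case/orP => /eqP r0; [left|right] => _ ->.
by apply/orP; case: (irrS _ _ (zc p) (zc q) cov) => sub; [left|right];
  apply/asboolP => x Sx; exact: (sub x Sx).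
Qed.

HB.instance Definition _ := isPrimeIdealrClosed.Build _ vanishing vanishing_prime.

Definition vanishing_ideal : prime_idealr {mpoly C[n]} := vanishing.

Definition coord_ring : Type := {ideal_quot vanishing_ideal}.
HB.instance Definition _ := GRing.ComNzRing.on coord_ring.

Definition cr_unit : pred coord_ring := fun x => `[< exists y, y * x = 1 >].
Definition cr_inv (x : coord_ring) : coord_ring :=
  if pselect (exists y, y * x = 1) is left h then sval (cid h) else x.

Lemma cr_mulVx : {in cr_unit, left_inverse 1 cr_inv *%R}.
Proof.
move=> x /asboolP ux; rewrite /cr_inv; case: pselect => // h.
by case: (cid h).
Qed.

Lemma cr_unitPl (x y : coord_ring) : y * x = 1 -> cr_unit x.
Proof. by move=> yx1; apply/asboolP; exists y. Qed.

Lemma cr_inv_out : {in [predC cr_unit], cr_inv =1 id}.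
Proof.
by move=> x /negP ux; rewrite /cr_inv; case: pselect => // h; case: ux; apply/asboolP.
Qed.

HB.instance Definition _ := GRing.ComNzRing_hasMulInverse.Build coord_ring
  cr_mulVx cr_unitPl cr_inv_out.

Lemma cr_integral (x y : coord_ring) : x * y = 0 -> (x == 0) || (y == 0).
Proof. exact: (@Quotient.rquot_IdomainAxiom _ vanishing_ideal). Qed.

HB.instance Definition _ := GRing.ComUnitRing_isIntegral.Build coord_ring
  cr_integral.

Definition funfield : fieldType := {fraction coord_ring}.

(* The rational function on S induced by a polynomial. *)
Definition ff_poly (p : {mpoly C[n]}) : funfield :=
  tofrac (\pi_({ideal_quot vanishing_ideal})%qT p : coord_ring).

Definition ff_const (c : C) : funfield := ff_poly c%:MP.

Definition ff_polyQ (p : {mpoly rat[n]}) : funfield :=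
  ff_poly (map_mpoly ratr p).

(* [f] induces the well-defined rational function [x] on S. *)
Definition induces (f : {fraction {mpoly rat[n]}}) (x : funfield) : Prop :=
  exists p q : {mpoly rat[n]},
    [/\ f = tofrac p / tofrac q, ff_polyQ q != 0 & x = ff_polyQ p / ff_polyQ q].

(* Q(S), as a subfield of C(S). *)
Definition ff_rational : {pred funfield} := fun x =>
  `[< exists p q : {mpoly rat[n]},
        ff_polyQ q != 0 /\ x = ff_polyQ p / ff_polyQ q >].

(* C-valued places of C(S) over C; None is the point at infinity. *)
Record place : Type := Place {
  pl_val :> funfield -> option C;
  pl_const : forall c, pl_val (ff_const c) = Some c;
  pl_add : forall x y a b,
    pl_val x = Some a -> pl_val y = Some b -> pl_val (x + y) = Some (a + b);
  pl_mul : forall x y a b,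
    pl_val x = Some a -> pl_val y = Some b -> pl_val (x * y) = Some (a * b);
  pl_inf : forall x, pl_val x = None -> pl_val x^-1 = Some 0
}.

(* The valuation ring of phi contains the local ring of S at u. *)
Definition place_at (u : aff C n) (phi : place) : Prop :=
  forall p q : {mpoly C[n]}, q.@[u] != 0 -> phi (ff_poly p / ff_poly q) <> None.

Definition value_at (u : aff C n) (x : funfield) (a : C) : Prop :=
  forall phi : place, place_at u phi -> phi x = Some a.

Definition determined (x : funfield) : Prop :=
  forall u, irr_set S u -> exists a, value_at u x a.

End FunctionField.

Section Families.

Variables (C : numClosedFieldType) (r : nat).

(* The last of the r + 1 variables is Y. *)
Definition forget_last (x : aff C r.+1) : aff C r := fun i => x (lift ord_max i).

Definition param_closure (Bs : seq {mpoly rat[r.+1]}) : set (aff C r) :=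
  zclosure [set forget_last x | x in system_set C Bs].

(* The image in Q(S)[Y] of a polynomial in Q[U_1, ..., U_r, Y]. *)
Definition induced (S : irrset C r) (B : {mpoly rat[r.+1]}) :
    {poly funfield S} :=
  mmap (fun c => (ratr c)%:P)
    (fun i => if unlift ord_max i is Some j then (ff_poly S 'X_j)%:P else 'X) B.

Record alg_family (Bs : seq {mpoly rat[r.+1]}) : Type := AlgFamily {
  af_neq0 : 0 \notin Bs;
  af_nonempty : system_set C Bs !=set0;
  af_irreducible : zirreducible (param_closure Bs);
  af_induced : has (fun B => induced (IrrSet af_irreducible) B != 0) Bs
}.

Definition param_space Bs (A : alg_family Bs) : irrset C r :=
  IrrSet (af_irreducible A).

Definition family_polys Bs (A : alg_family Bs) :
    seq {poly funfield (param_space A)} :=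
  [seq b <- map (induced (param_space A)) Bs | b != 0].

Definition is_monic_gcd (S : irrset C r) (bs : seq {poly funfield S})
    (h : {poly funfield S}) : Prop :=
  [/\ h \is monic, h \is a polyOver (@ff_rational _ _ S),
      all (fun b => h %| b)%R bs
    & forall d, d \is a polyOver (@ff_rational _ _ S) ->
        all (fun b => d %| b)%R bs -> (d %| h)%R].

Definition is_parametric (S : irrset C r) (h : {poly funfield S}) : Prop :=
  (1 <= (size h).-1)%N /\ forall k, determined h`_k.

Definition squarefree (S : irrset C r) (h : {poly funfield S}) : Prop :=
  forall d, d \is a polyOver (@ff_rational _ _ S) ->
    (d ^+ 2 %| h)%R -> (size d <= 1)%N.

(* Any algebraically closed extension L of C(S) contains an algebraic closure
   of Q(S), and with it all zeroes of polynomials over Q(S). *)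
Definition same_zeroes (S : irrset C r) (g h : {poly funfield S}) : Prop :=
  forall (L : closedFieldType) (iota : {rmorphism funfield S -> L}) (y : L),
    root (map_poly iota g) y = root (map_poly iota h) y.

Definition is_gsq_param_gcd Bs (A : alg_family Bs)
    (hh : {poly funfield (param_space A)}) : Prop :=
  exists h, is_monic_gcd (family_polys A) h /\
  [/\ hh \is monic, hh \is a polyOver (@ff_rational _ _ (param_space A)),
      squarefree hh, same_zeroes hh h & is_parametric hh].

Arguments is_gsq_param_gcd [Bs] A hh.

Definition has_gsq_param_gcd Bs (A : alg_family Bs) : Prop :=
  exists hh, is_gsq_param_gcd A hh.

Definition represents (S : irrset C r) (H : {poly {fraction {mpoly rat[r]}}})
    (hh : {poly funfield S}) : Prop :=
  size H = size hh /\ forall k, induces H`_k hh`_k.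

(* A branching-free algorithm: the rational functions theta are the entries of
   a code, in one fixed encoding of univariate polynomials, of the polynomial
   represented by H. *)
Record gcd_algorithm (D : output_structure C) (S : irrset C r) : Type :=
  GcdAlgorithm {
    ga_index : os_index D 1;
    ga_theta : 'I_(enc_size (os_encoding ga_index)) -> funfield S;
    ga_poly : {poly {fraction {mpoly rat[r]}}}
  }.

Arguments ga_theta [D S] g _.

Definition ga_size (D : output_structure C) (S : irrset C r)
    (G : gcd_algorithm D S) : nat := enc_size (os_encoding (ga_index G)).

Definition to_upoly (p : {mpoly C[1]}) : {poly C} := mmap polyC (fun=> 'X) p.

Definition computes (D : output_structure C) (S : irrset C r)
    (G : gcd_algorithm D S) (hh : {poly funfield S}) : Prop :=
  [/\ represents (ga_poly G) hh,
      forall i, ga_theta G i \in @ff_rational _ _ S,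
      forall k, exists g : {mpoly rat[ga_size G]},
        hh`_k = mmap ratr (ga_theta G) g
    & forall u, irr_set S u ->
        exists (z : aff C (ga_size G)) (hu : {poly C}),
          [/\ forall i, value_at u (ga_theta G i) (z i),
              forall k, value_at u hh`_k hu`_k,
              enc_dom z
            & to_upoly (decode z) = hu]].

End Families.

Arguments alg_family C [r] Bs.
Arguments is_gsq_param_gcd [C r Bs] A hh.
Arguments has_gsq_param_gcd [C r Bs] A.

Record elimination_procedure (C : numClosedFieldType) (rep : input_representation)
    (D : output_structure C) : Type := EliminationProcedure {
  ep_elim : forall n, ex_formula rep n -> out_formula D n;
  ep_closure : forall n, out_formula D n -> system D n;
  ep_gcd : forall r (B : system D r.+1) (A : alg_family C (system_polys B)),
    has_gsq_param_gcd A -> gcd_algorithm D (param_space A)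
}.

(* Main.v *)
Require Import Defs.
From HB Require Import structures.
From mathcomp Require Import all_boot all_order all_algebra.
From mathcomp Require Import generic_quotient ring_quotient fraction.
From mathcomp Require Import boolp classical_sets reals complex.
From mathcomp Require Import mpoly.
From mathcomp Require Import ring zify.

Set Implicit Arguments.
Unset Strict Implicit.
Unset Printing Implicit Defensive.

Import Order.TTheory GRing.Theory Num.Theory.

Local Open Scope ring_scope.

(** The elimination procedure is run on one explicit family of formulas whose
    output needs exponentially many code coordinates.  Put [N = 2 ^ n].

    The formula [exists u z, a <> 0 /\ b = a u /\ c = a u^N /\ z = 1 + u y /\
    y^(N+1) + a z^N = 0] has length linear in [n], both with circuits (repeated
    squaring) and with sparse terms (binary exponents): see [incidence_formula].
    With [a = t] it describes the roots [y] of [y^(N+1) + t (1 + u y)^N] over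
    the points [(t, t u, t u^N)].  Their Zariski closure is the surface
    [b^N = a^(N-1) c], the cone over the curve [(1 : u : u^N)].  Eliminating the
    quantifiers and passing to the closure gives a short system, which is an
    algebraic family over the cone.  Its generically squarefree parametric gcd
    is [Y^(N+1) + t (1 + u Y)^N] ([root_poly_gsq]).  The coefficients
    [C(N, k) t u^k] are rational functions on the cone; each is determined at
    every point because the cone satisfies
    [(t u^k)^N = a^(N-k) c^k]: where [a = 0] and [k < N] only the value 0 is
    possible ([root_poly_parametric]).

    The lower bound is an infinitesimal one ([cone_code_size]).  The whole curve
    [t = 0] is contracted to the vertex 0 of the cone.  The functions [theta_i]
    computed by a branching-free algorithm have one value [z_i] at the vertex,
    so [theta_i = z_i + eta_i(u) t + O(t^2)] with [z_i] independent of [u].  The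
    coefficients of the gcd are fixed polynomials in the [theta_i], so their
    first-order terms [C(N, k) u^k], [0 <= k <= N], are linear combinations over
    C of the [eta_i].  These [N + 1] powers of [u] are linearly independent,
    hence there are more than [2 ^ n] functions [theta_i].  Their number is at
    most [T (T (T (400 (n + 1))))], which a polynomial bound on [T] would make
    polynomial in [n].

    That the gcd of the unknown system has the same zeroes as the expected
    polynomial is checked on specializations ([common_root_at_point]): a
    non-constant polynomial over the function field that divides the system and
    is coprime to the expected one would have, at a generic point of the cone, a
    root that lies on the closure of the incidence set but is not a root of the
    specialized polynomial. *)

(** * Values of fractions at a point of the base ring *)

Section LocalValues.

Variables (A : comNzRingType) (F K : fieldType).
Variables (j : {rmorphism A -> F}) (e : {rmorphism A -> K}).
Hypothesis kerj : forall a, j a = 0 -> e a = 0.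

(** A ring A with a map j to a field and a map e to K plays the part of a
    coordinate ring with an evaluation; the relation is evaluation on the local
    ring, which avoids localizing A. *)
Definition local_value (x : F) (v : K) : Prop :=
  exists p q, [/\ e q != 0, x = j p / j q & v = e p / e q].

Lemma j_neq0 a : e a != 0 -> j a != 0.
Proof. by apply: contra_neq => /kerj. Qed.

(** Equality of two fractions in F is an identity between numerators up to the
    kernel of j, and e kills that kernel. *)
Lemma local_value_uniq x v w : local_value x v -> local_value x w -> v = w.
Proof.
move=> [p [q [q0 -> ->]]] [p' [q' [q'0 /eqP eqx ->]]].
apply/eqP; rewrite eqr_div // -!rmorphM -subr_eq0 -rmorphB; apply/eqP/kerj.
by apply/eqP; rewrite rmorphB subr_eq0 !rmorphM -eqr_div ?j_neq0.
Qed.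

Lemma local_value_j a : local_value (j a) (e a).
Proof. by exists a, 1; rewrite !rmorph1 !divr1 oner_eq0. Qed.

Lemma local_value0 : local_value 0 0.
Proof. by rewrite -(rmorph0 j) -(rmorph0 e); apply: local_value_j. Qed.

Lemma local_value1 : local_value 1 1.
Proof. by rewrite -(rmorph1 j) -(rmorph1 e); apply: local_value_j. Qed.

Lemma local_valueD x y v w :
  local_value x v -> local_value y w -> local_value (x + y) (v + w).
Proof.
move=> [p [q [q0 -> ->]]] [p' [q' [q'0 -> ->]]].
exists (p * q' + p' * q), (q * q'); split; first by rewrite rmorphM mulf_neq0.
  by rewrite addf_div ?j_neq0 // rmorphD !rmorphM.
by rewrite addf_div // rmorphD !rmorphM.
Qed.

Lemma local_valueM x y v w :
  local_value x v -> local_value y w -> local_value (x * y) (v * w).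
Proof.
move=> [p [q [q0 -> ->]]] [p' [q' [q'0 -> ->]]].
exists (p * p'), (q * q'); split; first by rewrite rmorphM mulf_neq0.
  by rewrite mulf_div !rmorphM.
by rewrite mulf_div !rmorphM.
Qed.

Lemma local_valueX x v k : local_value x v -> local_value (x ^+ k) (v ^+ k).
Proof.
move=> xv; elim: k => [|k IHk]; first by rewrite !expr0; apply: local_value1.
by rewrite !exprS; apply: local_valueM.
Qed.

Lemma local_valueV x v : v != 0 -> local_value x v -> local_value x^-1 v^-1.
Proof.
move=> v0 [p [q [q0 -> vE]]]; exists q, p; rewrite !invf_div vE invf_div.
by move: v0; rewrite vE mulf_eq0 => /norP[].
Qed.

Lemma local_value_sum (I : Type) (r : seq I) (P : pred I) (f : I -> F) (g : I -> K) :
  (forall i, P i -> local_value (f i) (g i)) ->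
  local_value (\sum_(i <- r | P i) f i) (\sum_(i <- r | P i) g i).
Proof.
move=> fg; elim/big_rec2: _ => [|i x y Pi xy]; first exact: local_value0.
by apply: local_valueD => //; apply: fg.
Qed.

Definition specializes (P : {poly F}) (P' : {poly K}) : Prop :=
  forall k, local_value P`_k P'`_k.

Lemma specializes_uniq P P' P'' : specializes P P' -> specializes P P'' -> P' = P''.
Proof. by move=> h1 h2; apply/polyP => k; apply: local_value_uniq (h1 k) (h2 k). Qed.

Lemma specializesD P P' Q Q' : specializes P P' -> specializes Q Q' ->
  specializes (P + Q) (P' + Q').
Proof. by move=> hP hQ k; rewrite !coefD; apply: local_valueD. Qed.

Lemma specializesM P P' Q Q' : specializes P P' -> specializes Q Q' ->
  specializes (P * Q) (P' * Q').
Proof.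
by move=> hP hQ k; rewrite !coefM; apply: local_value_sum => i _; apply: local_valueM.
Qed.

Lemma specializesC x v : local_value x v -> specializes x%:P v%:P.
Proof. by move=> xv k; rewrite !coefC; case: eqP => // _; apply: local_value0. Qed.

Lemma specializesX : specializes 'X 'X.
Proof.
move=> k; rewrite !coefX; case: eqP => _ /=; first exact: local_value1.
exact: local_value0.
Qed.

Lemma specializesXn P P' k : specializes P P' -> specializes (P ^+ k) (P' ^+ k).
Proof.
move=> h; elim: k => [|k IHk]; last by rewrite !exprS; apply: specializesM.
by rewrite !expr0; apply: specializesC local_value1.
Qed.

Lemma specializes_deriv P P' : specializes P P' -> specializes P^`() P'^`().
Proof.
move=> h k; rewrite !coef_deriv -mulr_natr -[P'`__ *+ _]mulr_natr; apply: local_valueM => //.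
by rewrite -(rmorph_nat j) -(rmorph_nat e); apply: local_value_j.
Qed.

End LocalValues.

Section Lift.

Variables (A : comNzRingType) (F K : fieldType).
Variables (j : {rmorphism A -> F}) (f : {rmorphism A -> K}).
Hypothesis jK : forall x, exists p q, j q != 0 /\ x = j p / j q.
Hypothesis ker : forall a, (j a == 0) = (f a == 0).

(** The universal property of a field of fractions whose ring need not embed
    into it: only the two kernels have to agree. *)
Lemma lift_fraction : exists g : {rmorphism F -> K}, forall a, g (j a) = f a.
Proof.
have kerj a : j a = 0 -> f a = 0 by move/eqP; rewrite ker => /eqP.
have ex x : exists v, local_value j f x v.
  by have [p [q [q0 ->]]] := jK x; exists (f p / f q), p, q; rewrite -ker.
pose g x := sval (cid (ex x)).
have gP x : local_value j f x (g x) by rewrite /g; case: cid.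
have gj a : g (j a) = f a.
  exact: (local_value_uniq kerj) (gP _) (local_value_j _ _ _).
have gD : zmod_morphism g.
  move=> x y; apply: (local_value_uniq kerj) (gP _) _.
  rewrite -mulN1r -[- g y]mulN1r; apply: (local_valueD kerj) => //.
  apply: local_valueM => //.
  by rewrite -(rmorph1 j) -(rmorph1 f) -!rmorphN; apply: local_value_j.
have gM : monoid_morphism g.
  split; first by rewrite -(rmorph1 j) gj rmorph1.
  by move=> x y; apply: (local_value_uniq kerj) (gP _) _; apply: local_valueM.
pose gz := GRing.isZmodMorphism.Build F K g gD.
pose gm := GRing.isMonoidMorphism.Build F K g gM.
pose gg : {rmorphism F -> K} := HB.pack g gz gm.
by exists gg.
Qed.

End Lift.

(** * Specialization at generic points and places of R(X) *)

Section GenericPoints.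

Variables (A : comNzRingType) (F : fieldType) (K : closedFieldType) (I : Type).
Variables (j : {rmorphism A -> F}) (e : I -> {rmorphism A -> K}).
Hypothesis jK : forall x, exists p q, j q != 0 /\ x = j p / j q.
Hypothesis kerj : forall i a, j a = 0 -> e i a = 0.
Hypothesis dense : forall a, j a != 0 -> exists i, e i a != 0.

(** Finitely many fractions only need finitely many denominators and nonzero
    numerators to be avoided, and their product is again nonzero in F. *)
Lemma regular_point (xs : seq F) : exists i, forall x, x \in xs ->
  exists v, local_value j (e i) x v /\ (x != 0 -> v != 0).
Proof.
suff [q [q0 qP]] : exists q, j q != 0 /\ forall i, e i q != 0 ->
    forall x, x \in xs -> exists v, local_value j (e i) x v /\ (x != 0 -> v != 0).
  by have [i iq] := dense q0; exists i; apply: qP.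
elim: xs => [|x xs [q [q0 qP]]]; first by exists 1; split; rewrite ?rmorph1 ?oner_eq0.
have [p [r [r0 xE]]] := jK x.
pose p1 := if x == 0 then 1 else p.
have p10 : j p1 != 0.
  rewrite /p1; case: (x =P 0) => [_|/eqP]; first by rewrite rmorph1 oner_eq0.
  by rewrite xE mulf_eq0 => /norP[].
exists (q * (r * p1)); split; first by rewrite !rmorphM !mulf_neq0.
move=> i; rewrite !rmorphM !mulf_eq0 => /norP[iq /norP[ir ip]] y.
rewrite inE => /predU1P[-> {y}|]; last exact: qP.
exists (e i p / e i r); split; first by exists p, r.
move=> x0; rewrite mulf_neq0 ?invr_eq0 //.
by move: ip; rewrite /p1 (negPf x0).
Qed.

Lemma specializes_size i (P : {poly F}) :
  (forall x, x \in polyseq P -> exists v, local_value j (e i) x v /\ (x != 0 -> v != 0)) ->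
  exists P', specializes j (e i) P P' /\ size P' = size P.
Proof.
move=> hP; pose v x :=
  if pselect (exists v, local_value j (e i) x v /\ (x != 0 -> v != 0)) is left h
  then sval (cid h) else 0.
have vP x : x \in polyseq P -> local_value j (e i) x (v x) /\ (x != 0 -> v x != 0).
  by move=> /hP h; rewrite /v; case: pselect => // h'; case: cid.
exists (\poly_(k < size P) v P`_k); split.
  move=> k; rewrite coef_poly; case: ltnP => kP; first by have [] := vP _ (mem_nth 0 kP).
  by rewrite nth_default //; apply: local_value0.
have [->|P0] := eqVneq P 0; first by rewrite size_poly0 poly_def big_ord0 size_poly0.
rewrite size_poly_eq //; apply: (vP _ _).2; last by rewrite -lead_coefE lead_coef_eq0.
by rewrite mem_nth // prednK // size_poly_gt0.
Qed.

(** Specialize a Bezout relation between d and h and the cofactors of d in bs at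
    a point where all coefficients are defined and d keeps its degree: d then
    has a root in the closed field K, which the Bezout relation keeps away from
    the roots of h.  This replaces the Nullstellensatz for families over a
    variety with a dense set of known points. *)
Lemma common_root_at_point (d h : {poly F}) (bs : seq {poly F}) :
  (1 < size d)%N -> all (fun b => d %| b) bs -> coprimep d h ->
  exists i y h', [/\ specializes j (e i) h h', h'.[y] != 0 &
    forall b, b \in bs -> exists b', specializes j (e i) b b' /\ root b' y].
Proof.
move=> d1 /allP dbs /Bezout_eq1_coprimepP[[u v] /= uv1].
pose ps := [:: d; u; v; h] ++ [seq b %/ d | b <- bs].
have [i iP] := regular_point (flatten (map polyseq ps)).
have sp p : p \in ps -> exists P', specializes j (e i) p P' /\ size P' = size p.
  move=> pps; apply: specializes_size => x xp; apply: iP.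
  by apply/flattenP; exists (polyseq p) => //; apply: map_f.
have [|d' [dd' sd']] := sp d; first by rewrite inE eqxx.
have [|u' [uu' _]] := sp u; first by rewrite !inE eqxx orbT.
have [|v' [vv' _]] := sp v; first by rewrite !inE eqxx !orbT.
have [|h' [hh' _]] := sp h; first by rewrite !inE eqxx !orbT.
have uv1' : u' * d' + v' * h' = 1.
  apply: (specializes_uniq (@kerj i)) (_ : specializes j (e i) 1 _) _.
    rewrite -uv1; apply: (specializesD (@kerj i)); exact: (specializesM (@kerj i)).
  by apply: specializesC; apply: local_value1.
have /closed_rootP[y dy] : size d' != 1%N by rewrite sd'; case: (size d) d1 => [|[]].
exists i, y, h'; split => //.
  apply: contra_eqN (congr1 (horner^~ y) uv1') => /eqP h'y.
  by rewrite hornerD !hornerM h'y (eqP dy) !mulr0 addr0 hornerC eq_sym oner_eq0.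
move=> b bbs; have [|c' [cc' _]] := sp (b %/ d).
  by rewrite mem_cat (map_f (fun b => b %/ d)) // orbT.
exists (c' * d'); split; last by rewrite rootM dy orbT.
by rewrite -(divpK (dbs _ bbs)); apply: (specializesM (@kerj i)).
Qed.

End GenericPoints.

Section FractionField.

Import FracField.

Lemma fracE (R : idomainType) (x : {fraction R}) :
  exists p q : R, tofrac q != 0 /\ x = tofrac p / tofrac q.
Proof.
elim/quotW: x => x; exists \n_x, \d_x.
have d0 : tofrac \d_x != 0 by rewrite tofrac_eq0 denom_ratioP.
split=> //; apply: (canRL (mulfK d0)).
rewrite -[LHS]/(FracField.mul _ _) !piE; apply/eqmodP; rewrite /= equivfE /mulf.
by rewrite !numden_Ratio ?mulf_neq0 ?denom_ratioP ?oner_eq0 // !mulr1 mulrC.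
Qed.

End FractionField.

Lemma tofrac_cancelr (R : idomainType) (r s x : R) : tofrac x != 0 ->
  tofrac (r * x) / tofrac (s * x) = tofrac r / tofrac s.
Proof. by move=> x0; rewrite (tofracM r) (tofracM s) -mulf_div divff ?mulr1. Qed.

Section FractionPlace.

Variables (R : idomainType) (L : fieldType) (f : {rmorphism R -> L}) (a : R).
Hypothesis f_inj : injective f.

(** Evaluation at X = a, with values in a field L that contains R.  For R = C[u]
    and a = 0 this is t = 0 with values in C(u); for R = C it is u = a. *)
Definition at_point : {poly R} -> L := f \o horner_eval a.
HB.instance Definition _ := GRing.RMorphism.on at_point.

Definition frac_value := local_value (@tofrac {poly R}) at_point.

Lemma tofrac_ker (p : {poly R}) : tofrac p = 0 -> at_point p = 0.
Proof. by move/eqP; rewrite tofrac_eq0 => /eqP ->; rewrite rmorph0. Qed.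

Lemma at_point_XsubC (p : {poly R}) m :
  at_point (p * ('X - a%:P) ^+ m) = f (p.[a]) * 0 ^+ m.
Proof.
by rewrite /at_point /= /horner_eval hornerM horner_exp hornerXsubC subrr
           rmorphM rmorphXn rmorph0.
Qed.

(** Powers of X - a cancel between numerator and denominator, so one of x and
    its inverse is regular at a, and the inverse vanishes there if x is not. *)
Lemma frac_value_total x : (exists v, frac_value x v) \/ frac_value x^-1 0.
Proof.
have [p [q [q0 ->]]] := fracE x; rewrite tofrac_eq0 in q0.
have [->|p0] := eqVneq p 0.
  by left; exists 0; rewrite rmorph0 mul0r; apply: local_value0.
have X0 : tofrac ('X - a%:P) != 0 by rewrite tofrac_eq0 polyXsubC_eq0.
have [m [p1 /(implyP) /(_ p0) p1a pE]] := multiplicity_XsubC p a.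
have [n [q1 /(implyP) /(_ q0) q1a qE]] := multiplicity_XsubC q a.
have fa0 (r : {poly R}) : ~~ root r a -> at_point r != 0.
  by rewrite /at_point /= /horner_eval -(rmorph0 f) (inj_eq f_inj).
have shift (r s : {poly R}) k l : (k <= l)%N -> ~~ root s a ->
    frac_value (tofrac (r * ('X - a%:P) ^+ l) / tofrac (s * ('X - a%:P) ^+ k))
      (f r.[a] * 0 ^+ (l - k) / at_point s).
  move=> kl sa; exists (r * ('X - a%:P) ^+ (l - k)), s.
  split; [exact: fa0 | | by rewrite /= at_point_XsubC].
  have -> : r * ('X - a%:P) ^+ l = r * ('X - a%:P) ^+ (l - k) * ('X - a%:P) ^+ k.
    by rewrite -mulrA -exprD subnK.
  by rewrite tofrac_cancelr ?tofracXn ?expf_neq0.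
have [nm|mn] := leqP n m; [left|right].
  by rewrite pE qE; eexists; apply: shift.
rewrite invf_div pE qE.
have := shift q1 p1 _ _ (ltnW mn) p1a.
by rewrite expr0n subn_eq0 leqNgt mn /= mulr0 mul0r.
Qed.

Definition frac_place (x : {fraction {poly R}}) : option L :=
  if pselect (exists v, frac_value x v) is left h then Some (sval (cid h)) else None.

Lemma frac_placeP x v : frac_place x = Some v <-> frac_value x v.
Proof.
rewrite /frac_place; case: pselect => [h|h]; last by split=> // xv; case: h; exists v.
case: cid => /= w xw; split=> [[<-] //|xv]; congr Some.
exact: (local_value_uniq tofrac_ker) xw xv.
Qed.

Lemma frac_place_inf x : frac_place x = None -> frac_value x^-1 0.
Proof.
by have [[v /frac_placeP ->] //|] := frac_value_total x.
Qed.

End FractionPlace.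

(** * First-order expansions along t = 0 *)

Section Tangent.

Variable C : numClosedFieldType.

Local Notation K1 := {fraction {poly C}}.
Local Notation K2 := {fraction {poly {poly C}}}.

Definition const2 : C -> K2 := @tofrac {poly {poly C}} \o (polyC \o polyC).
HB.instance Definition _ := GRing.RMorphism.on const2.

Definition const1 : C -> K1 := @tofrac {poly C} \o polyC.
HB.instance Definition _ := GRing.RMorphism.on const1.

Definition t2 : K2 := tofrac 'X.
Definition u2 : K2 := tofrac 'X%:P.
Definition u1 : K1 := tofrac 'X.

Definition t_value : K2 -> K1 -> Prop := frac_value (@tofrac {poly C}) 0.
Definition u_value (a : C) : K1 -> C -> Prop := frac_value (@idfun C) a.

Lemma t_value_const c : t_value (const2 c) (const1 c).
Proof.
have := local_value_j (@tofrac {poly {poly C}}) (at_point (@tofrac {poly C}) 0) c%:P%:P.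
by rewrite /at_point /= /horner_eval hornerC.
Qed.

Lemma t_value_t : t_value t2 0.
Proof.
have := local_value_j (@tofrac {poly {poly C}}) (at_point (@tofrac {poly C}) 0) 'X.
by rewrite /at_point /= /horner_eval hornerX rmorph0.
Qed.

Lemma t_value_u : t_value u2 u1.
Proof.
have := local_value_j (@tofrac {poly {poly C}}) (at_point (@tofrac {poly C}) 0) 'X%:P.
by rewrite /at_point /= /horner_eval hornerC.
Qed.

Definition t_valueD := local_valueD (@tofrac_ker _ _ (@tofrac {poly C}) 0).
Definition t_valueM :=
  @local_valueM _ _ _ (@tofrac {poly {poly C}}) (at_point (@tofrac {poly C}) 0).
Definition t_value_uniq := local_value_uniq (@tofrac_ker _ _ (@tofrac {poly C}) 0).

Lemma t2_neq0 : t2 != 0.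
Proof. by rewrite tofrac_eq0 polyX_eq0. Qed.

Lemma poly_fun_eq0 (p : {poly C}) : (forall a, p.[a] = 0) -> p = 0.
Proof.
move=> p0; apply/eqP/negPn/negP => nzp.
pose rs := [seq i%:R : C | i <- iota 0 (size p)].
have := @max_poly_roots _ p rs nzp.
rewrite size_map size_iota ltnn => /(_ _ _)/implyP.
case: allP => [_|[]]; last by move=> a _; rewrite /root p0.
rewrite map_inj_uniq ?iota_uniq //= => [/(_ isT isT)//|i k /eqP].
by rewrite eqr_nat => /eqP.
Qed.

(** A rational function of u with the same value at all points is constant: it
    agrees with z at the infinitely many points where its denominator is not 0. *)
Lemma u_value_const (r : K1) z : (forall a, u_value a r z) -> r = const1 z.
Proof.
move=> rz; have [p [q [q0 rE]]] := fracE r; rewrite tofrac_eq0 in q0.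
suff /eqP : (p - z%:P * q) * q = 0.
  rewrite mulf_eq0 (negPf q0) orbF subr_eq0 => /eqP pE.
  by rewrite rE pE tofracM mulfK // tofrac_eq0.
apply: poly_fun_eq0 => a; rewrite !hornerE.
have [->|qa] := eqVneq q.[a] 0; first by rewrite mulr0.
have ra : u_value a r (p.[a] / q.[a]) by exists p, q.
by rewrite -(local_value_uniq (@tofrac_ker _ _ (@idfun C) a) ra (rz a)) divfK // subrr mul0r.
Qed.

(** [x = c + d(u) t + O(t^2)] with [c] independent of [u]. *)
Definition first_order (x : K2) (c : C) (d : K1) : Prop :=
  exists w, x = const2 c + t2 * w /\ t_value w d.

Lemma first_order_uniq x c c' d d' :
  first_order x c d -> first_order x c' d' -> c = c' /\ d = d'.
Proof.
move=> [w [xE wd]] [w' [xE' wd']].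
have xc b (e : K1) v : x = const2 b + t2 * v -> t_value v e -> t_value x (const1 b).
  move=> -> ve; have -> : const1 b = const1 b + 0 * e by rewrite mul0r addr0.
  by apply: t_valueD; [exact: t_value_const | apply: t_valueM => //; exact: t_value_t].
have cc : c = c'.
  apply: (fmorph_inj (@const1 : {rmorphism C -> K1})).
  exact: t_value_uniq (xc _ _ _ xE wd) (xc _ _ _ xE' wd').
split=> //; move: xE; rewrite xE' cc => /addrI /(mulfI t2_neq0) ww.
by apply: t_value_uniq wd _; rewrite -ww.
Qed.

Lemma first_order_exists x c : t_value x (const1 c) -> exists d, first_order x c d.
Proof.
move=> [p [q [q0 xE vE]]].
have /factor_theorem[r rE] : root (p - c%:P%:P * q) 0.
  move: vE q0; rewrite /at_point /= /horner_eval => vE q0.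
  rewrite rootE hornerD hornerN hornerM hornerC -(tofrac_eq0 (_ - _)) rmorphB rmorphM /=.
  have -> : tofrac c%:P = const1 c by [].
  by rewrite vE divfK ?subrr.
have q0' : tofrac q != 0 by apply: j_neq0 q0; exact: tofrac_ker.
exists (tofrac r.[0] / tofrac q.[0]), (tofrac r / tofrac q); split; last by exists r, q.
rewrite xE; apply: (canLR (mulfK q0')); rewrite mulrDl -mulrA divfK //.
rewrite -!tofracM -tofracD; congr tofrac.
by rewrite subr0 in rE; rewrite [_ * r]mulrC -rE addrC subrK.
Qed.

Lemma first_order_const c : first_order (const2 c) c 0.
Proof. by exists 0; split; [rewrite mulr0 addr0 | exact: local_value0]. Qed.

Lemma first_orderD x x' c c' d d' : first_order x c d -> first_order x' c' d' ->
  first_order (x + x') (c + c') (d + d').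
Proof.
move=> [w [-> wd]] [w' [-> wd']]; exists (w + w'); split; last exact: t_valueD.
by rewrite rmorphD mulrDr addrACA.
Qed.

Lemma first_orderM x x' c c' d d' : first_order x c d -> first_order x' c' d' ->
  first_order (x * x') (c * c') (const1 c * d' + const1 c' * d).
Proof.
move=> [w [-> wd]] [w' [-> wd']].
exists (const2 c * w' + const2 c' * w + t2 * (w * w')); split.
  by rewrite rmorphM mulrDl !mulrDr; ring.
have -> : const1 c * d' + const1 c' * d = const1 c * d' + const1 c' * d + 0 * (d * d').
  by rewrite mul0r addr0.
by do ![exact: t_value_const | exact: t_value_t | assumption
      | apply: t_valueD | apply: t_valueM].
Qed.

Section Bound.

Variables (m : nat) (theta : 'I_m -> K2) (z : 'I_m -> C) (eta : 'I_m -> K1).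
Hypothesis thetaP : forall i, first_order (theta i) (z i) (eta i).

(** The subring of C(t, u) in which every element has a constant value at t = 0
    and a first-order term in the C-span of the eta i. *)
Definition tangent_span (x : K2) : Prop :=
  exists c (v : 'I_m -> C), first_order x c (\sum_i const1 (v i) * eta i).

Lemma tangent_span_const c : tangent_span (const2 c).
Proof.
exists c, (fun=> 0); rewrite big1 => [|i _]; first exact: first_order_const.
by rewrite rmorph0 mul0r.
Qed.

Lemma tangent_span_theta i : tangent_span (theta i).
Proof.
exists (z i), (fun k => (k == i)%:R); rewrite (bigD1 i) //= eqxx rmorph1 mul1r.
by rewrite big1 ?addr0 // => k /negPf ->; rewrite rmorph0 mul0r.
Qed.

Lemma tangent_spanD x y : tangent_span x -> tangent_span y -> tangent_span (x + y).
Proof.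
move=> [c [v xv]] [d [w yw]]; exists (c + d), (fun i => v i + w i).
under eq_bigr do rewrite rmorphD mulrDl.
by rewrite big_split; apply: first_orderD.
Qed.

(** The Leibniz rule: the values at t = 0 are scalars of C, so products do not
    leave the C-span of the eta i. *)
Lemma tangent_spanM x y : tangent_span x -> tangent_span y -> tangent_span (x * y).
Proof.
move=> [c [v xv]] [d [w yw]]; exists (c * d), (fun i => c * w i + d * v i).
under eq_bigr do rewrite rmorphD !rmorphM mulrDl -!mulrA.
by rewrite big_split -!mulr_sumr; apply: first_orderM.
Qed.

Lemma tangent_span_mmap (g : {mpoly C[m]}) : tangent_span (mmap const2 theta g).
Proof.
have span0 : tangent_span 0 by rewrite -(rmorph0 const2); apply: tangent_span_const.
have span1 : tangent_span 1 by rewrite -(rmorph1 const2); apply: tangent_span_const.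
apply: (big_ind tangent_span); [exact: span0 | exact: tangent_spanD | move=> s _].
apply: tangent_spanM; first exact: tangent_span_const.
apply: (big_ind tangent_span); [exact: span1 | exact: tangent_spanM | move=> i _].
elim: (s i) => // k IHk; rewrite exprS; apply: tangent_spanM => //.
exact: tangent_span_theta.
Qed.

(** The first-order terms [a k u^k] lie in the span of the m elements eta i, and
    they are linearly independent over C. *)
Lemma tangent_bound N (g : 'I_N -> {mpoly C[m]}) (a : 'I_N -> C) :
  (forall k, a k != 0) ->
  (forall k, mmap const2 theta (g k) = const2 (a k) * t2 * u2 ^+ k) -> (N <= m)%N.
Proof.
move=> a0 gE.
have /(_ _)/cid fo k : exists v : 'I_m -> C,
    const1 (a k) * u1 ^+ k = \sum_i const1 (v i) * eta i.
  have [c [v]] := tangent_span_mmap (g k); rewrite gE => fo; exists v.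
  suff /(first_order_uniq fo)[] : first_order (const2 (a k) * t2 * u2 ^+ k) 0
    (const1 (a k) * u1 ^+ k) by [].
  exists (const2 (a k) * u2 ^+ k); split; first by rewrite rmorph0 add0r mulrCA mulrA.
  apply: t_valueM; first exact: t_value_const.
  apply: (@local_valueX _ _ _ (@tofrac {poly {poly C}}) (at_point (@tofrac {poly C}) 0)).
  exact: t_value_u.
pose M : 'M[C]_(N, m) := \matrix_(k, i) sval (fo k) i.
suff : row_free M by move=> /eqP <-; apply: rank_leq_col.
apply: inj_row_free => v vM0.
pose P : {poly C} := \sum_k (v 0 k * a k) *: 'X^k.
have P0 : P = 0.
  apply/eqP; rewrite -(tofrac_eq0 P) rmorph_sum /=.
  have -> : \sum_k tofrac ((v 0 k * a k) *: 'X^k) =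
            \sum_k const1 (v 0 k) * \sum_i const1 (M k i) * eta i.
    apply: eq_bigr => k _; under eq_bigr do rewrite mxE.
    by rewrite -(svalP (fo k)) mulrA -rmorphM -mul_polyC tofracM tofracXn.
  under eq_bigr do rewrite mulr_sumr.
  rewrite exchange_big big1 // => i _.
  under eq_bigr do rewrite mulrA -rmorphM.
  rewrite -mulr_suml -rmorph_sum /=.
  have := congr1 (fun B : 'M_(_,_) => B 0 i) vM0; rewrite !mxE => ->.
  by rewrite rmorph0 mul0r.
apply/rowP => k; rewrite mxE; have := congr1 (fun p : {poly C} => p`_k) P0.
rewrite coef0 coef_sum (bigD1 k) //= coefZ coefXn eqxx mulr1 big1 ?addr0.
  by move/eqP; rewrite mulf_eq0 (negPf (a0 k)) orbF => /eqP.
move=> i ik; rewrite coefZ coefXn (_ : (k == i :> nat) = false) ?mulr0 //.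
by rewrite val_eqE eq_sym; apply: negbTE.
Qed.

End Bound.

End Tangent.

(** * Costs of input terms *)

Section InputTerms.

Variable v : nat.
Local Notation mp := {mpoly int[v]}.

Definition input_cost rep (p : mp) (s : nat) : Prop :=
  exists t : input_term rep v, input_poly t = p /\ (input_size t <= s)%N.

(** The last node computes p and every element of S is available at some node,
    so that gates can be appended one at a time. *)
Definition dag_computes (p : mp) (S : seq mp) (s : nat) : Prop :=
  exists k (c : dag v k.+1), [/\ (dag_size c <= s)%N, dag_poly c ord_max = p
    & forall q, q \in p :: S -> exists i, dag_poly c i = q].

Lemma circuit_cost p S s : dag_computes p S s -> input_cost ArithmeticCircuit p s.
Proof. by move=> [k [c [cs cp _]]]; exists (Circuit c). Qed.

Lemma dag_snoc_last k (c : dag v k) (g : gate v k) :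
  dag_poly (DagSnoc c g) ord_max = gate_poly (dag_poly c) g.
Proof. by rewrite /= unlift_none. Qed.

Lemma dag_snoc_lift k (c : dag v k) (g : gate v k) i :
  dag_poly (DagSnoc c g) (lift ord_max i) = dag_poly c i.
Proof. by rewrite /= liftK. Qed.

Lemma dag_step p S s k (c : dag v k.+1) (g : gate v k.+1) q :
  [/\ (dag_size c <= s)%N, dag_poly c ord_max = p
    & forall q, q \in p :: S -> exists i, dag_poly c i = q] ->
  gate_poly (dag_poly c) g = q -> dag_computes q (p :: S) (s + gate_size g).
Proof.
move=> [cs cp cS] gq; exists k.+1, (DagSnoc c g); split.
- by rewrite /= leq_add2r.
- by rewrite dag_snoc_last.
move=> r; rewrite inE => /predU1P[-> | /cS[i <-]].
  by exists ord_max; rewrite dag_snoc_last.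
by exists (lift ord_max i); rewrite dag_snoc_lift.
Qed.

Lemma dag_start i : dag_computes 'X_i [::] 1.
Proof.
exists 0%N, (DagSnoc (@DagNil v) (GVar 0 i)); split=> //; first by rewrite dag_snoc_last.
by move=> q; rewrite inE => /eqP ->; exists ord_max; rewrite dag_snoc_last.
Qed.

Lemma dag_var i p S s : dag_computes p S s -> dag_computes 'X_i (p :: S) (s + 1).
Proof. by move=> [k [c h]]; apply: (@dag_step _ _ _ _ c (GVar _ i)) h _. Qed.

Lemma dag_one p S s : dag_computes p S s -> dag_computes 1 (p :: S) (s + 3).
Proof. by move=> [k [c h]]; apply: (@dag_step _ _ _ _ c (GConst _ _ 1%:Z)) h _. Qed.

Lemma dag_add q r p S s : dag_computes p S s -> q \in p :: S -> r \in p :: S ->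
  dag_computes (q + r) (p :: S) (s + 1).
Proof.
move=> [k [c h]] qS rS; have [_ _ cS] := h.
have [i iq] := cS _ qS; have [l lr] := cS _ rS.
by apply: (@dag_step _ _ _ _ c (GAdd _ i l)) h _; rewrite /= iq lr.
Qed.

Lemma dag_sub q r p S s : dag_computes p S s -> q \in p :: S -> r \in p :: S ->
  dag_computes (q - r) (p :: S) (s + 1).
Proof.
move=> [k [c h]] qS rS; have [_ _ cS] := h.
have [i iq] := cS _ qS; have [l lr] := cS _ rS.
by apply: (@dag_step _ _ _ _ c (GSub _ i l)) h _; rewrite /= iq lr.
Qed.

Lemma dag_mul q r p S s : dag_computes p S s -> q \in p :: S -> r \in p :: S ->
  dag_computes (q * r) (p :: S) (s + 1).
Proof.
move=> [k [c h]] qS rS; have [_ _ cS] := h.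
have [i iq] := cS _ qS; have [l lr] := cS _ rS.
by apply: (@dag_step _ _ _ _ c (GMul _ i l)) h _; rewrite /= iq lr.
Qed.

Lemma dag_weaken p S S' s : {subset S' <= p :: S} ->
  dag_computes p S s -> dag_computes p S' s.
Proof.
move=> sS [k [c [cs cp cS]]]; exists k, c; split=> // q.
by rewrite inE => /predU1P[-> | /sS]; apply: cS; rewrite inE eqxx.
Qed.

(** Repeated squaring: a power of exponent 2 ^ m costs m gates. *)
Lemma dag_square_power p S s m : dag_computes p S s ->
  dag_computes (p ^+ (2 ^ m)) (p :: S) (s + m).
Proof.
move=> h; elim: m => [|m IHm].
  by rewrite expn0 expr1 addn0; apply: (dag_weaken _ h).
rewrite addnS -(addn1 (s + m)) expnSr exprM expr2.
have := dag_mul IHm (mem_head _ _) (mem_head _ _); apply: dag_weaken.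
by move=> q qS; rewrite in_cons [X in _ || X]in_cons qS !orbT.
Qed.

Lemma bitsize_pow e m : (e <= 2 ^ m)%N -> (bitsize e%:Z <= m.+2)%N.
Proof.
move=> em; rewrite /bitsize !ltnS absz_nat.
case: e em => [|e] em; first by rewrite trunc_log0.
by rewrite -(leq_exp2l (m := 2)) //; apply: leq_trans em; apply: trunc_logP.
Qed.

(** Exponents are written in binary, so a term costs about m bits per variable
    even though its degree is exponential in m. *)
Lemma sparse_cost (s : seq (int * 'X_{1..v})) m :
  all (fun t : int * 'X_{1..v} => (`|t.1|%N == 1%N) && [forall i : 'I_v, (t.2 i <= 2 ^ m)%N]) s ->
  input_cost SparseEncoding (\sum_(t <- s) t.1 *: 'X_[t.2]) (size s * (2 + v * m.+2)).
Proof.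
move=> hs; exists s; split=> //=; rewrite /sparse_size.
rewrite -sum1_size big_distrl /= !big_seq; apply: leq_sum => t /(allP hs).
case/andP=> /eqP t1 /forallP t2; rewrite mul1n; apply: leq_add.
  by rewrite /bitsize t1.
rewrite -[v in leqRHS]card_ord -sum_nat_const; apply: leq_sum => i _.
exact: bitsize_pow.
Qed.

End InputTerms.

(** * The input formula *)

Section Formula.

Variables (rep : input_representation) (n : nat).
Local Notation N := (2 ^ n)%N.

Definition coord_a : 'I_3 := ord0.
Definition coord_b : 'I_3 := @Ordinal 3 1 isT.
Definition coord_c : 'I_3 := ord_max.

Lemma ord3_cases (i : 'I_3) : i <> coord_a -> i <> coord_b -> i = coord_c.
Proof.
case: i => [[|[|[|k]]] lti] // na nb; apply/val_inj => //.
  by case: na; apply: val_inj.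
by case: nb; apply: val_inj.
Qed.

(** The order of the variables is a, b, c, y, then the quantified u and z; the
    position of y is the one that the last variable of a family has. *)
Definition param_var (i : 'I_3) : 'I_(4 + 2) := lshift 2 (lift ord_max i).
Local Notation xa := (param_var coord_a).
Local Notation xb := (param_var coord_b).
Local Notation xc := (param_var coord_c).
Definition root_var : 'I_(4 + 2) := lshift 2 ord_max.
Definition slope_var : 'I_(4 + 2) := rshift 4 ord0.
Definition base_var : 'I_(4 + 2) := rshift 4 ord_max.
Local Notation xy := root_var.
Local Notation xu := slope_var.
Local Notation xz := base_var.
Local Notation mp := {mpoly int[4 + 2]}.

Definition eq_b : mp := 'X_xb - 'X_xa * 'X_xu.
Definition eq_c : mp := 'X_xc - 'X_xa * 'X_xu ^+ N.
Definition eq_base : mp := 'X_xz - (1 + 'X_xu * 'X_xy).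
Definition eq_root : mp := 'X_xy ^+ N * 'X_xy + 'X_xa * 'X_xz ^+ N.

(** Three monomials in six variables with exponents at most [2 ^ n.+1]: each
    exponent takes at most n + 3 bits, each coefficient 2. *)
Definition term_bound := (18 * n + 60)%N.

Lemma input_cost_circuit :
  [/\ input_cost ArithmeticCircuit 'X_xa term_bound,
      input_cost ArithmeticCircuit eq_b term_bound,
      input_cost ArithmeticCircuit eq_c term_bound,
      input_cost ArithmeticCircuit eq_base term_bound &
      input_cost ArithmeticCircuit eq_root term_bound].
Proof.
have le (p : mp) S s : dag_computes p S s -> (s <= term_bound)%N ->
    input_cost ArithmeticCircuit p term_bound.
  move=> /circuit_cost[t [tp ts]] sb; exists t; split=> //; exact: leq_trans sb.
have mem2 (p q : mp) S : q \in p :: q :: S by rewrite !inE eqxx orbT.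
have mem3 (p q r : mp) S : r \in p :: q :: r :: S by rewrite !inE eqxx !orbT.
have mem4 (p q r s : mp) S : s \in p :: q :: r :: s :: S by rewrite !inE eqxx !orbT.
split.
- by apply: (le _ _ _ (dag_start xa)); rewrite /term_bound; lia.
- have h := dag_var xb (dag_var xu (dag_start xa)).
  have {}h := dag_mul h (mem3 _ _ _ _) (mem2 _ _ _).
  have {}h := dag_sub h (mem2 _ _ _) (mem_head _ _).
  by apply: (le _ _ _ h); rewrite /term_bound; lia.
- have h := dag_var xa (dag_square_power n (dag_start xu)).
  have {}h := dag_mul h (mem_head _ _) (mem2 _ _ _).
  have {}h := dag_var xc h.
  have {}h := dag_sub h (mem_head _ _) (mem2 _ _ _).
  by apply: (le _ _ _ h); rewrite /term_bound; lia.
- have h := dag_var xy (dag_start xu).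
  have {}h := dag_mul h (mem2 _ _ _) (mem_head _ _).
  have {}h := dag_one h.
  have {}h := dag_add h (mem_head _ _) (mem2 _ _ _).
  have {}h := dag_var xz h.
  have {}h := dag_sub h (mem_head _ _) (mem2 _ _ _).
  by apply: (le _ _ _ h); rewrite /term_bound; lia.
have h := dag_var xa (dag_square_power n (dag_start xz)).
have {}h := dag_mul h (mem_head _ _) (mem2 _ _ _).
have {}h := dag_square_power n (dag_var xy h).
have {}h := dag_mul h (mem_head _ _) (mem2 _ _ _).
have {}h := dag_add h (mem_head _ _) (mem4 _ _ _ _ _).
by apply: (le _ _ _ h); rewrite /term_bound; lia.
Qed.

Lemma input_cost_sparse :
  [/\ input_cost SparseEncoding 'X_xa term_bound,
      input_cost SparseEncoding eq_b term_bound,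
      input_cost SparseEncoding eq_c term_bound,
      input_cost SparseEncoding eq_base term_bound &
      input_cost SparseEncoding eq_root term_bound].
Proof.
have le (s : seq (int * 'X_{1..4 + 2})) p :
    all (fun t : int * 'X_{1..4 + 2} =>
      (`|t.1|%N == 1%N) && [forall i : 'I_(4 + 2), (t.2 i <= 2 ^ n.+1)%N]) s ->
    (size s <= 3)%N -> \sum_(t <- s) t.1 *: 'X_[t.2] = p ->
    input_cost SparseEncoding p term_bound.
  move=> /sparse_cost[t [tp ts]] s3 <-; exists t; split=> //.
  apply: leq_trans ts _; rewrite /term_bound; nia.
have N0 : (0 < N)%N by rewrite expn_gt0.
have ex_le (e : 'X_{1..4 + 2}) : (forall i, (e i <= N + 1)%N) ->
    [forall i : 'I_(4 + 2), (e i <= 2 ^ n.+1)%N].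
  by move=> eN; apply/forallP => i; rewrite expnS; have := eN i; lia.
split.
- apply: (le [:: (1, U_(xa)%MM)]) => //=; last by rewrite big_seq1 /= scale1r.
  by rewrite andbT; apply: ex_le => i; rewrite mnm1E; case: eqP => _ /=; lia.
- apply: (le [:: (1, U_(xb)%MM); (-1, (U_(xa) + U_(xu))%MM)]) => //=.
    rewrite andbT; apply/andP; split; apply: ex_le => i;
    by rewrite ?mnmDE !mnm1E; do ?[case: eqP => _ /=]; lia.
  by rewrite big_cons big_seq1 /= scale1r scaleN1r mpolyXD.
- apply: (le [:: (1, U_(xc)%MM); (-1, (U_(xa) + U_(xu) *+ N)%MM)]) => //=.
    rewrite andbT; apply/andP; split; apply: ex_le => i;
    by rewrite ?mnmDE ?mulmnE !mnm1E; do ?[case: eqP => _ /=]; lia.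
  by rewrite big_cons big_seq1 /= scale1r scaleN1r mpolyXD -mpolyXn.
- apply: (le [:: (1, U_(xz)%MM); (-1, 0%MM); (-1, (U_(xu) + U_(xy))%MM)]) => //=.
    rewrite andbT; apply/and3P; split; apply: ex_le => i;
    by rewrite ?mnmDE ?mnm0E ?mnm1E; do ?[case: eqP => _ /=]; lia.
  by rewrite !big_cons big_nil addr0 /= scale1r !scaleN1r mpolyXD mpolyX0 -opprD.
apply: (le [:: (1, (U_(xy) *+ N + U_(xy))%MM); (1, (U_(xa) + U_(xz) *+ N)%MM)]) => //=.
  rewrite andbT; apply/andP; split; apply: ex_le => i;
  by rewrite ?mnmDE ?mulmnE !mnm1E; do ?[case: eqP => _ /=]; lia.
by rewrite big_cons big_seq1 /= !scale1r !mpolyXD -!mpolyXn.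
Qed.

Lemma input_costs :
  [/\ input_cost rep 'X_xa term_bound, input_cost rep eq_b term_bound,
      input_cost rep eq_c term_bound, input_cost rep eq_base term_bound &
      input_cost rep eq_root term_bound].
Proof. by case: rep; [exact: input_cost_circuit | exact: input_cost_sparse]. Qed.

Definition root_relation (C : numClosedFieldType) (t u y : C) : Prop :=
  y ^+ N.+1 + t * (1 + u * y) ^+ N = 0.

Lemma join_pointl (C : Type) (x : aff C 4) (w : aff C 2) i :
  join_point x w (lshift 2 i) = x i.
Proof. by rewrite /join_point (unsplitK (inl i)). Qed.

Lemma join_pointr (C : Type) (x : aff C 4) (w : aff C 2) i :
  join_point x w (rshift 4 i) = w i.
Proof. by rewrite /join_point (unsplitK (inr i)). Qed.

Definition cone_point (C : numClosedFieldType) (t u : C) : aff C 3 :=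
  fun i => if i == coord_a then t else if i == coord_b then t * u else t * u ^+ N.

Definition incidence (C : numClosedFieldType) : set (aff C 4) :=
  [set x | exists t u, [/\ t != 0, root_relation t u (x ord_max) &
    forget_last x = cone_point t u]]%classic.

Lemma incidence_formula (C : numClosedFieldType) :
  exists Phi : ex_formula rep 4,
    ex_set C Phi = @incidence C /\ (ex_length Phi <= 400 * n.+1)%N.
Proof.
have [[ta [tap tas]] [tb [tbp tbs]] [tc [tcp tcs]] [tz [tzp tzs]] [ty [typ tys]]]
  := input_costs.
pose Phi := @ExFormula rep 4 2 (QAnd (QNot (QAtom ta))
  (QAnd (QAtom tb) (QAnd (QAtom tc) (QAnd (QAtom tz) (QAtom ty))))).
exists Phi; split; last first.
  (* Five terms, five connectives and six variables. *)
  rewrite /ex_length /=; move: tas tbs tcs tzs tys.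
  rewrite /term_bound; lia.
rewrite /ex_set /=; apply/seteqP; split=> x /=.
  move=> [w]; rewrite tap tbp tcp tzp typ.
  rewrite /eq_b /eq_c /eq_base /eq_root !(rmorphB, rmorphD, rmorphM, rmorphXn, rmorph1) /=.
  rewrite !mmapX !mmap1U /param_var /root_var /slope_var /base_var.
  rewrite !join_pointl !join_pointr => -[/eqP a0 [b0 [c0 [z0 y0]]]].
  exists (x (lift ord_max coord_a)), (w ord0); split=> //.
    by rewrite /root_relation exprSr -(subr0_eq z0).
  apply/funext => i; rewrite /forget_last /cone_point.
  case: eqP => [-> //|ia]; case: eqP => [->|ib]; first exact: subr0_eq.
  by rewrite (ord3_cases ia ib); apply: subr0_eq.
move=> [t [u [t0 yr xE]]].
(* The quantified variables are the slope u and the base z = 1 + u y. *)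
exists (fun k => if k == ord0 then u else 1 + u * x ord_max).
rewrite tap tbp tcp tzp typ.
rewrite /eq_b /eq_c /eq_base /eq_root !(rmorphB, rmorphD, rmorphM, rmorphXn, rmorph1) /=.
rewrite !mmapX !mmap1U /param_var /root_var /slope_var /base_var.
rewrite !join_pointl !join_pointr /=.
have xi i : x (lift ord_max i) = cone_point t u i by rewrite -xE.
rewrite !xi /cone_point /= !subrr; split; first exact: (elimN eqP t0).
by do 3![split=> //]; rewrite -exprSr.
Qed.

End Formula.

Section ExtendPoint.

Variable C : numClosedFieldType.

Definition extend_point (s : aff C 3) (y : C) : aff C 4 :=
  fun l => if unlift ord_max l is Some l' then s l' else y.

Lemma extend_point_last s y : extend_point s y ord_max = y.
Proof. by rewrite /extend_point unlift_none. Qed.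

Lemma forget_extend_point s y : forget_last (extend_point s y) = s.
Proof. by apply/funext => l; rewrite /forget_last /extend_point liftK. Qed.

End ExtendPoint.

(** * Zariski closures and function fields *)

Section FunctionFields.

Variables (C : numClosedFieldType) (r : nat) (S : irrset C r).

(** A single polynomial already defines a closed set, so membership in the
    closure can be tested one polynomial at a time. *)
Lemma zclosureP k (A : set (aff C k)) x : zclosure A x <->
  forall p : {mpoly C[k]}, (forall y, A y -> p.@[y] = 0) -> p.@[x] = 0.
Proof.
split=> [clx p pA | h B [[I ->] AB] p Ip]; last first.
  by apply: h => y /AB; apply.
have := clx (zeros [set p]%classic); apply; last by [].
by split=> [|y /pA py q ->//]; exists [set p]%classic.
Qed.

Lemma sub_zclosure k (A : set (aff C k)) x : A x -> zclosure A x.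
Proof. by move=> Ax; apply/zclosureP => p; apply. Qed.

(** A polynomial map is continuous, so taking the closure before the image does
    not change the closure of the image. *)
Lemma zclosure_image k l (A : set (aff C k)) (f : aff C k -> aff C l)
    (q : {mpoly C[l]} -> {mpoly C[k]}) :
  (forall p x, (q p).@[x] = p.@[f x]) ->
  zclosure [set f x | x in zclosure A]%classic = zclosure [set f x | x in A]%classic.
Proof.
move=> qE; apply/seteqP; split=> y /zclosureP yA; apply/zclosureP => p pA; apply: yA.
  move=> _ [x /zclosureP xA <-]; rewrite -qE; apply: xA => z Az; rewrite qE.
  by apply: pA; exists z.
by move=> _ [x Ax <-]; apply: pA; exists x => //; apply: sub_zclosure.
Qed.

Lemma ff_poly_zmod : zmod_morphism (@ff_poly C r S).
Proof. by move=> p q; rewrite /ff_poly rmorphB tofracB. Qed.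

Lemma ff_poly_monoid : monoid_morphism (@ff_poly C r S).
Proof.
by split=> [|p q]; rewrite /ff_poly ?rmorph1 ?rmorphM ?tofrac1 ?tofracM.
Qed.

HB.instance Definition _ := GRing.isZmodMorphism.Build _ _ (@ff_poly C r S) ff_poly_zmod.
HB.instance Definition _ := GRing.isMonoidMorphism.Build _ _ (@ff_poly C r S) ff_poly_monoid.

Lemma ff_polyB p q : ff_poly S (p - q) = ff_poly S p - ff_poly S q.
Proof. exact: rmorphB. Qed.
Lemma ff_polyM p q : ff_poly S (p * q) = ff_poly S p * ff_poly S q.
Proof. exact: rmorphM. Qed.
Lemma ff_polyXn p k : ff_poly S (p ^+ k) = ff_poly S p ^+ k.
Proof. exact: rmorphXn. Qed.

Lemma ff_poly_eq0 p : ff_poly S p = 0 <-> forall x, irr_set S x -> p.@[x] = 0.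
Proof.
have -> : (ff_poly S p = 0) = (p \in vanishing_ideal S).
  rewrite -[p in RHS]subr0 Quotient.idealrBE rmorph0; apply/propext.
  rewrite /ff_poly; split=> [/eqP | p0]; first by rewrite tofrac_eq0.
  by apply/eqP; rewrite tofrac_eq0.
by split=> /asboolP.
Qed.

Lemma ff_fraction (x : funfield S) :
  exists p q : {mpoly C[r]}, ff_poly S q != 0 /\ x = ff_poly S p / ff_poly S q.
Proof.
have [p [q [q0 ->]]] := fracE x.
exists (repr p), (repr q); rewrite /ff_poly !reprK; by split.
Qed.

End FunctionFields.

(** * Places of a function field *)

Section PlaceValues.

Variables (C : numClosedFieldType) (r : nat) (S : irrset C r) (phi : place S).

Lemma place0 : phi 0 = Some 0.
Proof. by have := pl_const phi 0; rewrite /ff_const !rmorph0. Qed.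

Lemma place1 : phi 1 = Some 1.
Proof. by have := pl_const phi 1; rewrite /ff_const !rmorph1. Qed.

Lemma placeX x v k : phi x = Some v -> phi (x ^+ k) = Some (v ^+ k).
Proof.
move=> xv; elim: k => [|k IHk]; first by rewrite !expr0 place1.
by rewrite !exprS; apply: pl_mul.
Qed.

(** Places are integrally closed: an element with a finite power is finite. *)
Lemma place_pow_eq0 x y k : (0 < k)%N -> x ^+ k = y -> phi y = Some 0 -> phi x = Some 0.
Proof.
move=> k0 xy y0; case xE: (phi x) => [v|].
  move: (placeX k xE); rewrite xy y0 => -[/esym/eqP]; rewrite expf_eq0 k0 /=.
  by move=> /eqP ->.
have x0 : x != 0 by apply: contra_eq_neq xE => ->; rewrite place0.
have := pl_mul (placeX k (pl_inf xE)) y0.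
rewrite -xy -exprMn mulVf // expr1n place1 mulr0 => -[/eqP].
by rewrite oner_eq0.
Qed.

Variable (u : aff C r).
Hypotheses (Su : irr_set S u) (phi_u : place_at u phi).

Lemma ff_poly_neq0 q : q.@[u] != 0 -> ff_poly S q != 0.
Proof. by apply: contra_neq => /ff_poly_eq0; apply. Qed.

(** If the value v differed from p(u), then p - v would be invertible in the
    local ring at u and yet have the value 0. *)
Lemma place_poly p : phi (ff_poly S p) = Some p.@[u].
Proof.
case pE: (phi (ff_poly S p)) => [v|]; last first.
  have := @phi_u p 1; rewrite [ff_poly S 1]rmorph1 divr1 meval1 oner_eq0 pE.
  by case.
congr Some; apply/eqP; rewrite eq_sym -subr_eq0; apply/negPn/negP => q0.
pose q := p + (- v)%:MP.
have qu : q.@[u] != 0 by rewrite mevalD mevalC.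
have := @phi_u 1 q qu; rewrite [ff_poly S 1]rmorph1 div1r.
case qE: (phi (ff_poly S q)^-1) => [w|] // _.
have qv : phi (ff_poly S q) = Some (v - v).
  by rewrite rmorphD; apply: pl_add => //; apply: pl_const.
have := pl_mul qv qE; rewrite divff ?ff_poly_neq0 // place1 subrr mul0r => -[/eqP].
by rewrite oner_eq0.
Qed.

Lemma place_fraction p q : q.@[u] != 0 ->
  phi (ff_poly S p / ff_poly S q) = Some (p.@[u] / q.@[u]).
Proof.
move=> qu; case xE: (phi _) => [v|]; last by have := @phi_u p q qu; rewrite xE.
have := pl_mul xE (place_poly q); rewrite divfK ?ff_poly_neq0 // place_poly => -[->].
by rewrite mulfK.
Qed.

End PlaceValues.

Section PulledBackPlace.

Variables (C : numClosedFieldType) (r : nat) (S : irrset C r) (b : C).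
Variable iota : {rmorphism funfield S -> {fraction {poly {poly C}}}}.
Hypothesis iota_const : forall c, iota (ff_const S c) = const2 c.

(** The place of rank two given by t = 0 followed by u = b, restricted to a
    subfield of C(t, u). *)
Definition tu_value (x : funfield S) (v : C) : Prop :=
  exists2 w, t_value (iota x) w & u_value b w v.

Definition tu_place_fun (x : funfield S) : option C :=
  obind (frac_place (@idfun C) b) (frac_place (@tofrac {poly C}) 0 (iota x)).

Lemma tu_placeP x v : tu_place_fun x = Some v <-> tu_value x v.
Proof.
rewrite /tu_place_fun; split.
  case xw: frac_place => [w|] //= /frac_placeP wv; exists w => //.
  by apply/frac_placeP.
by move=> [w /frac_placeP xw /frac_placeP wv]; rewrite xw.
Qed.

Lemma tu_value_const c : tu_value (ff_const S c) c.
Proof.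
exists (const1 c); first by rewrite iota_const; apply: t_value_const.
have := local_value_j (@tofrac {poly C}) (at_point (@idfun C) b) c%:P.
by rewrite /at_point /= /horner_eval hornerC.
Qed.

Lemma tu_valueD x y v w : tu_value x v -> tu_value y w -> tu_value (x + y) (v + w).
Proof.
move=> [v' xv vv] [w' yw ww]; exists (v' + w'); first by rewrite rmorphD; apply: t_valueD.
exact: (local_valueD (@tofrac_ker _ _ (@idfun C) b)).
Qed.

Lemma tu_valueM x y v w : tu_value x v -> tu_value y w -> tu_value (x * y) (v * w).
Proof.
move=> [v' xv vv] [w' yw ww]; exists (v' * w'); first by rewrite rmorphM; apply: t_valueM.
exact: local_valueM.
Qed.

Lemma tofrac_poly_inj : injective (@tofrac {poly C}).
Proof. by move=> p q /eqP; rewrite tofrac_eq => /eqP. Qed.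

Lemma tu_value_inf x : tu_place_fun x = None -> tu_value x^-1 0.
Proof.
rewrite /tu_place_fun; case xw: (frac_place _ _ (iota x)) => [w|] /=; last first.
  move=> _; exists 0; last by apply: local_value0.
  by rewrite fmorphV; apply: frac_place_inf xw; apply: tofrac_poly_inj.
move=> wN; exists w^-1; last by apply: frac_place_inf wN => ? ?.
rewrite fmorphV; apply: local_valueV; last exact/frac_placeP.
apply: contra_eq_neq wN => ->.
by have /frac_placeP -> : frac_value (@idfun C) b 0 0 by apply: local_value0.
Qed.

Lemma tu_place_constP c : tu_place_fun (ff_const S c) = Some c.
Proof. exact/tu_placeP/tu_value_const. Qed.

Lemma tu_place_add x y v w : tu_place_fun x = Some v -> tu_place_fun y = Some w ->
  tu_place_fun (x + y) = Some (v + w).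
Proof. by rewrite !tu_placeP; apply: tu_valueD. Qed.

Lemma tu_place_mul x y v w : tu_place_fun x = Some v -> tu_place_fun y = Some w ->
  tu_place_fun (x * y) = Some (v * w).
Proof. by rewrite !tu_placeP; apply: tu_valueM. Qed.

Lemma tu_place_inf x : tu_place_fun x = None -> tu_place_fun x^-1 = Some 0.
Proof. by rewrite tu_placeP; apply: tu_value_inf. Qed.

Definition tu_place : place S :=
  Place tu_place_constP tu_place_add tu_place_mul tu_place_inf.

(** Values of polynomials suffice: a denominator with a nonzero value at o has a
    finite inverse. *)
Lemma tu_place_at (o : aff C r) :
  (forall p, tu_value (ff_poly S p) p.@[o]) -> place_at o tu_place.
Proof.
move=> po p q qo /=.
suff /tu_placeP -> : tu_value (ff_poly S p / ff_poly S q) (p.@[o] / q.@[o]) by [].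
apply: tu_valueM => //; have [w qw wq] := po q.
exists w^-1; last exact: local_valueV.
rewrite fmorphV; apply: local_valueV => //.
apply: contra_neq qo => w0; rewrite w0 in wq.
exact: (local_value_uniq (@tofrac_ker _ _ (@idfun C) b)) wq (local_value0 _ _).
Qed.

End PulledBackPlace.

(** * The cone over the curve (1 : u : u^N) *)

Lemma rmorph_mmap (k : nat) (R S T : nzRingType) (phi : {rmorphism S -> T}) (f : R -> S)
  (h : 'I_k -> S) p : phi (mmap f h p) = mmap (phi \o f) (phi \o h) p.
Proof.
rewrite /mmap rmorph_sum; apply: eq_bigr => m _; rewrite rmorphM /mmap1 rmorph_prod.
by congr (_ * _); apply: eq_bigr => i _; rewrite rmorphXn.
Qed.

Lemma eq_mmap (k : nat) (R S : nzRingType) (f f' : R -> S) (h h' : 'I_k -> S) p :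
  f =1 f' -> h =1 h' -> mmap f h p = mmap f' h' p.
Proof.
move=> ff hh; apply: eq_bigr => m _; rewrite ff /mmap1.
by congr (_ * _); apply: eq_bigr => i _; rewrite hh.
Qed.

Section Cone.

Variables (C : numClosedFieldType) (n : nat).
Local Notation N := (2 ^ n)%N.

Definition cone_points : set (aff C 3) :=
  [set x | exists t u, t != 0 /\ x = cone_point n t u]%classic.

Definition cone_closure : set (aff C 3) := zclosure cone_points.

Definition cone_coord (i : 'I_3) : {poly {poly C}} :=
  if i == coord_a then 'X else if i == coord_b then 'X * 'X%:P else 'X * 'X%:P ^+ N.

Definition pull : {mpoly C[3]} -> {poly {poly C}} := mmap (polyC \o polyC) cone_coord.
HB.instance Definition _ := GRing.RMorphism.on pull.

Lemma pullB p q : pull (p - q) = pull p - pull q. Proof. exact: rmorphB. Qed.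
Lemma pullM p q : pull (p * q) = pull p * pull q. Proof. exact: rmorphM. Qed.
Lemma pullXn p k : pull (p ^+ k) = pull p ^+ k. Proof. exact: rmorphXn. Qed.

Definition eval2 (t u : C) : {poly {poly C}} -> C := horner_eval u \o horner_eval t%:P.
HB.instance Definition _ t u := GRing.RMorphism.on (eval2 t u).

Lemma pull_eval p t u : eval2 t u (pull p) = p.@[cone_point n t u].
Proof.
rewrite rmorph_mmap; apply: eq_mmap => [c|i] /=.
  by rewrite /eval2 /= /horner_eval !hornerC.
rewrite /eval2 /= /horner_eval /cone_coord /cone_point.
by case: eqP => _; [|case: eqP => _]; rewrite ?hornerM ?horner_exp ?hornerX ?hornerC
  ?hornerM ?horner_exp ?hornerX ?hornerC.
Qed.

Lemma poly2_eq0 (P : {poly {poly C}}) : (forall t u, eval2 t u P = 0) -> P = 0.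
Proof.
move=> P0; apply/polyP => k; rewrite coef0; apply: poly_fun_eq0 => u.
pose Q := map_poly (horner_eval u) P.
suff -> : (P`_k).[u] = Q`_k.
  rewrite (_ : Q = 0) ?coef0 //; apply: poly_fun_eq0 => t.
  have := P0 t u; rewrite /eval2 /= /horner_eval => <-.
  rewrite -[t in LHS](hornerC t u) -[(t%:P).[u]]/(horner_eval u t%:P) horner_map.
  by [].
by rewrite coef_map.
Qed.

Lemma cone_pointP p : (forall x, cone_closure x -> p.@[x] = 0) <-> pull p = 0.
Proof.
split=> [p0 | p0 x /zclosureP]; last first.
  by apply=> y [t [u [_ ->]]]; rewrite -pull_eval p0 rmorph0.
(* The factor t takes care of the points with t = 0, which are not among those
   of the parametrization. *)
apply/eqP; have : pull p * 'X = 0.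
  have eX t u : eval2 t u 'X = t by rewrite /eval2 /= /horner_eval hornerX hornerC.
  apply: poly2_eq0 => t u; rewrite (rmorphM (eval2 t u)) [X in _ * X](eX t u).
  have [->|t0] := eqVneq t 0; first by rewrite mulr0.
  by rewrite [X in X * _](pull_eval p t u) p0 ?mul0r //; apply: sub_zclosure; exists t, u.
by move/eqP; rewrite mulf_eq0 polyX_eq0 orbF.
Qed.

Lemma cone_irreducible : zirreducible cone_closure.
Proof.
split.
  exists (cone_point n 1 0); apply: sub_zclosure; exists 1, 0.
  by rewrite oner_eq0.
move=> B B' [I ->] [I' ->] cov.
have [subI|] := pselect (cone_closure `<=` zeros I)%classic; first by left.
have [subI'|] := pselect (cone_closure `<=` zeros I')%classic; first by right.
(* If neither closed set contains the closure, each has among its equations one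
   with a nonzero pull-back, and C[t, u] is a domain. *)
have nz J : ~ (cone_closure `<=` zeros J)%classic -> exists2 p, J p & pull p != 0.
  move=> NJ; apply: contrapT => h; apply: NJ => x clx p Jp.
  move: x clx; apply/cone_pointP; apply/eqP/negPn/negP => p0; apply: h; exists p => //.
move=> /nz[p' Ip' p'0] /nz[p Ip p0].
have : pull p * pull p' = 0.
  rewrite -rmorphM; apply/cone_pointP => x /cov[] xI.
    by rewrite mevalM (xI _ Ip) mul0r.
  by rewrite mevalM (xI _ Ip') mulr0.
by move/eqP; rewrite mulf_eq0 (negPf p0) (negPf p'0).
Qed.

(** The curve t = 0 is contracted to the vertex 0. *)
Lemma pull_at0 p : (pull p).[0] = (p.@[fun=> 0])%:P.
Proof.
apply/eqP; rewrite -subr_eq0; apply/eqP/poly_fun_eq0 => u.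
have := pull_eval p 0 u; rewrite /eval2 /= /horner_eval polyC0 hornerE hornerN hornerC => ->.
rewrite (meval_eq (v2 := fun=> 0)) ?subrr // => i; rewrite /cone_point !mul0r.
by do 2?case: eqP.
Qed.

Lemma cone_origin : cone_closure (fun=> 0).
Proof.
apply/zclosureP => p p0.
have /(congr1 (fun q : {poly {poly C}} => q.[0].[0])) : pull p = 0.
  by apply/cone_pointP => x /zclosureP; apply.
by rewrite pull_at0 !hornerC.
Qed.

Variable S : irrset C 3.
Hypothesis S_cone : irr_set S = cone_closure.

Lemma ff_poly_pull p : (ff_poly S p == 0) = (pull p == 0).
Proof.
by apply/eqP/eqP; rewrite -cone_pointP ff_poly_eq0 S_cone.
Qed.

(** The parametrization of the cone embeds its function field into C(t, u). *)
Lemma cone_param : exists iota : {rmorphism funfield S -> {fraction {poly {poly C}}}},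
  forall p, iota (ff_poly S p) = tofrac (pull p).
Proof.
apply: (@lift_fraction _ _ _ (@ff_poly C 3 S) (@tofrac {poly {poly C}} \o pull)).
  exact: ff_fraction.
by move=> p; rewrite ff_poly_pull /= tofrac_eq0.
Qed.

Definition fa : funfield S := ff_poly S 'X_coord_a.
Definition fb : funfield S := ff_poly S 'X_coord_b.
Definition fc : funfield S := ff_poly S 'X_coord_c.

Definition root_poly : {poly funfield S} := 'X^(N.+1) + fa *: (1 + (fb / fa) *: 'X) ^+ N.

Lemma root_poly_coef k : root_poly`_k =
  if (k <= N)%N then fa * (fb / fa) ^+ k *+ 'C(N, k) else (k == N.+1)%:R.
Proof.
rewrite /root_poly coefD coefXn coefZ exprDn.
under eq_bigr do rewrite expr1n mul1r exprZn.
have -> : (\sum_(i < N.+1) ((fb / fa) ^+ i *: 'X^i) *+ 'C(N, i))`_k =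
    if (k <= N)%N then (fb / fa) ^+ k *+ 'C(N, k) else 0.
  rewrite coef_sum; case: leqP => kN.
    rewrite (bigD1 (inord k)) //= coefMn coefZ coefXn inordK ?ltnS // eqxx mulr1.
    rewrite big1 ?addr0 // => i ik; rewrite coefMn coefZ coefXn.
    rewrite (_ : (k == i) = false) ?mulr0 ?mul0rn //; apply: contraNF ik => /eqP ki.
    by apply/eqP/val_inj; rewrite /= ki inord_val.
  rewrite big1 // => i _; rewrite coefMn coefZ coefXn.
  by rewrite (_ : (k == i) = false) ?mulr0 ?mul0rn // gtn_eqF // (leq_ltn_trans _ kN) // -ltnS.
case: leqP => kN; last by rewrite mulr0 addr0.
by rewrite ltn_eqF ?ltnS // add0r mulrnAr.
Qed.

Lemma pullX i : pull 'X_i = cone_coord i.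
Proof. by rewrite /pull mmapX mmap1U. Qed.

Section LowerBound.

Variables (m : nat) (theta : 'I_m -> funfield S).
Hypothesis theta_det : forall i, exists z, value_at (fun=> 0) (theta i) z.
Hypothesis theta_gen : forall k, exists g : {mpoly rat[m]}, root_poly`_k = mmap ratr theta g.

(** The values of theta at the vertex can be computed along every place t = 0,
    u = b; they do not depend on b, so theta has a constant value at t = 0.  The
    coefficients of the root polynomial are [C(N, k) t u^k], which makes the
    tangent bound applicable. *)
Lemma cone_code_size : (N < m)%N.
Proof.
have [iota iotaE] := cone_param.
have iota_const c : iota (ff_const S c) = const2 c.
  by rewrite /ff_const iotaE /pull mmapC.
have at_o b p : tu_value b iota (ff_poly S p) p.@[fun=> 0].
  exists (const1 p.@[fun=> 0]).
    rewrite iotaE /const1 /= -pull_at0.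
    exact: (local_value_j _ (at_point (@tofrac {poly C}) 0)).
  have := local_value_j (@tofrac {poly C}) (at_point (@idfun C) b) (p.@[fun=> 0])%:P.
  by rewrite /at_point /= /horner_eval hornerC.
have /(_ _)/cid th i : exists z : C * {fraction {poly C}},
    first_order (iota (theta i)) z.1 z.2.
  have [z zP] := theta_det i.
  have val b : tu_value b iota (theta i) z.
    apply/(@tu_placeP _ _ _ _ iota); apply: (zP (tu_place b iota_const)).
    exact: tu_place_at.
  (* The value w at t = 0 lies in C(u) and does not depend on b. *)
  have [w xw _] := val 0.
  have wz : w = const1 z.
    apply: u_value_const => b; have [w' xw' w'z] := val b.
    by rewrite (t_value_uniq xw xw').
  by rewrite wz in xw; have [d] := first_order_exists xw; exists (z, d).
have /(_ _)/cid gk k := theta_gen k.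
apply: (@tangent_bound C m (iota \o theta) (fun i => (sval (th i)).1)
  (fun i => (sval (th i)).2) (fun i => svalP (th i)) N.+1
  (fun k => map_mpoly ratr (sval (gk k))) (fun k => 'C(N, k)%:R)).
  by move=> k; rewrite pnatr_eq0 -lt0n bin_gt0 -ltnS.
move=> k; rewrite /map_mpoly rmorph_mmap.
have := congr1 iota (svalP (gk k)); rewrite rmorph_mmap => h.
transitivity (iota root_poly`_k).
  rewrite h; apply: eq_mmap => [q|i] /=; last by rewrite mmapX mmap1U.
  rewrite [LHS]mmapC [RHS](fmorph_rat iota).
  exact: (fmorph_rat (@const2 C : {rmorphism C -> {fraction {poly {poly C}}}})).
have ia : iota fa = t2 C by rewrite iotaE pullX.
have ib : iota fb = t2 C * u2 C by rewrite iotaE pullX /cone_coord /= tofracM.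
rewrite root_poly_coef -ltnS ltn_ord -mulr_natl !rmorphM rmorphXn rmorph_nat fmorph_div ia ib.
by rewrite [t2 C * u2 C]mulrC mulfK ?t2_neq0 // mulrA -(rmorph_nat (@const2 C)).
Qed.

End LowerBound.

End Cone.

(** * Greatest common divisors over a subfield *)

Section SubfieldGcd.

Variables (F : fieldType) (k : divringClosed F).

(** The elements of a division-closed predicate as a field of their own: gcds are
    compatible with the inclusion, hence gcds over F of polynomials over the
    subfield have coefficients in the subfield. *)
Record subfield_of : predArgType :=
  SubfieldOf { subfield_val :> F; subfield_valP : subfield_val \in k }.

HB.instance Definition _ := [isSub for subfield_val].
HB.instance Definition _ := [Choice of subfield_of by <:].
HB.instance Definition _ := [SubChoice_isSubComUnitRing of subfield_of by <:].
HB.instance Definition _ := [SubComUnitRing_isSubIntegralDomain of subfield_of by <:].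
HB.instance Definition _ := [SubIntegralDomain_isSubField of subfield_of by <:].

Lemma polyOver_lift (p : {poly F}) : p \is a polyOver k ->
  exists p' : {poly subfield_of}, p = map_poly val p'.
Proof.
move=> /polyOverP pk.
exists (\poly_(i < size p) (SubfieldOf (pk i))).
apply/polyP => i; rewrite coef_map coef_poly.
by case: ltnP => ip //; rewrite nth_default // rmorph0.
Qed.

Lemma map_val_polyOver (p : {poly subfield_of}) : map_poly val p \is a polyOver k.
Proof. by apply/polyOverP => i; rewrite coef_map; apply: valP. Qed.

Definition gcd_seq (G : fieldType) (bs : seq {poly G}) : {poly G} := foldr (@gcdp _) 0 bs.

Lemma dvdp_gcd_seq (d : {poly F}) bs : (d %| gcd_seq bs) = all (fun b => d %| b) bs.
Proof. by elim: bs => [|b bs IHbs] /=; rewrite ?dvdp0 // dvdp_gcd IHbs. Qed.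

(** The gcd over F is universal among all divisors over F, a fortiori among
    those over the subfield. *)
Lemma monic_gcd_exists (bs : seq {poly F}) :
  all (fun b => b \is a polyOver k) bs -> has (fun b => b != 0) bs ->
  exists h : {poly F}, [/\ h \is monic, h \is a polyOver k, all (fun b => h %| b) bs
    & forall d, all (fun b => d %| b) bs -> d %| h].
Proof.
move=> bsk bs0.
have [g gE] : exists g : {poly subfield_of}, gcd_seq bs = map_poly val g.
  elim: bs bsk {bs0} => [_|b bs IHbs /= /andP[/polyOver_lift[b' ->] /IHbs[g ->]]].
    by exists 0; rewrite rmorph0.
  by exists (gcdp b' g); rewrite (gcdp_map (val : {rmorphism subfield_of -> F})).
have h0 : gcd_seq bs != 0.
  apply: contraTneq bs0 => h0; rewrite -all_predC; apply/allP => b bbs /=.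
  have := dvdpp (gcd_seq bs); rewrite dvdp_gcd_seq => /allP/(_ _ bbs).
  by rewrite h0 dvd0p negbK.
have l0 : (lead_coef (gcd_seq bs))^-1 != 0 by rewrite invr_eq0 lead_coef_eq0.
exists ((lead_coef (gcd_seq bs))^-1 *: gcd_seq bs); split.
- by rewrite monicE lead_coefZ mulVf // lead_coef_eq0.
- rewrite gE polyOverZ ?map_val_polyOver // rpredV.
  by apply: (polyOverP _); apply: map_val_polyOver.
- have := dvdpp (gcd_seq bs); rewrite dvdp_gcd_seq; apply: sub_all => b.
  by rewrite dvdpZl.
by move=> d; rewrite -dvdp_gcd_seq dvdpZr.
Qed.

End SubfieldGcd.

Lemma fractions_closed (A : comNzRingType) (F : fieldType) (f : {rmorphism A -> F}) :
  divring_closed (fun x : F => `[< exists p q, f q != 0 /\ x = f p / f q >]).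
Proof.
split.
- by apply/asboolP; exists 1, 1; rewrite rmorph1 divr1 oner_eq0.
- move=> _ _ /asboolP[p [q [q0 ->]]] /asboolP[p' [q' [q'0 ->]]]; apply/asboolP.
  exists (p * q' - p' * q), (q * q'); split; first by rewrite rmorphM mulf_neq0.
  by rewrite -mulNr addf_div // rmorphB !rmorphM mulNr.
move=> _ _ /asboolP[p [q [q0 ->]]] /asboolP[p' [q' [q'0 ->]]]; apply/asboolP.
have [p'0|p'0] := eqVneq (f p') 0.
  by exists 0, 1; rewrite rmorph0 rmorph1 oner_eq0 p'0 mul0r invr0 mulr0 mul0r.
exists (p * q'), (q * p'); split; first by rewrite rmorphM mulf_neq0.
by rewrite invf_div mulf_div !rmorphM.
Qed.

Section RationalFunctions.

Variables (C : numClosedFieldType) (r : nat) (S : irrset C r).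

Lemma ff_rational_closed : divring_closed (@ff_rational C r S).
Proof. exact: (fractions_closed (@ff_poly C r S \o map_mpoly ratr)). Qed.

HB.instance Definition _ :=
  GRing.isDivringClosed.Build (funfield S) (@ff_rational C r S) ff_rational_closed.

Lemma ff_rational_polyQ p : ff_polyQ S p \in @ff_rational C r S.
Proof.
apply/asboolP; exists p, 1; split; rewrite /ff_polyQ rmorph1 [ff_poly S 1]rmorph1.
  exact: oner_neq0.
by rewrite divr1.
Qed.

Lemma ff_rationalX i : ff_poly S 'X_i \in @ff_rational C r S.
Proof. by have := ff_rational_polyQ 'X_i; rewrite /ff_polyQ map_mpolyX. Qed.

Lemma ff_poly_ratr c : ratr c = ff_poly S (ratr c)%:MP.
Proof.
by rewrite -[RHS]/((@ff_poly C r S \o @mpolyC r C) (ratr c)) fmorph_rat.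
Qed.

End RationalFunctions.

(** * The root polynomial and its specializations *)

Section RootPolynomial.

Variables (C : numClosedFieldType) (n : nat) (S : irrset C 3).
Hypothesis S_cone : irr_set S = @cone_closure C n.
Local Notation N := (2 ^ n)%N.
Local Notation fa := (fa S).
Local Notation fb := (fb S).
Local Notation fc := (fc S).
Local Notation rp := (root_poly n S).

Lemma N_gt0 : (0 < N)%N. Proof. by rewrite expn_gt0. Qed.

Lemma root_poly_size : size rp = N.+2.
Proof.
apply/eqP; rewrite eqn_leq; apply/andP; split.
  apply/leq_sizeP => k kN; rewrite root_poly_coef leqNgt (ltn_trans _ kN) //=.
  by rewrite gtn_eqF.
rewrite ltnNge; apply/negP => /leq_sizeP/(_ N.+1 (leqnn _))/eqP.
by rewrite root_poly_coef ltnn eqxx oner_eq0.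
Qed.

Lemma root_poly_monic : rp \is monic.
Proof. by rewrite monicE lead_coefE root_poly_size root_poly_coef ltnn eqxx. Qed.

Lemma root_poly_rational : rp \is a polyOver (@ff_rational C 3 S).
Proof.
apply/polyOverP => k; rewrite root_poly_coef; case: ifP => _; last exact: rpred_nat.
by rewrite rpredMn // rpredM ?rpredX ?rpred_div ?ff_rationalX.
Qed.

Lemma fa_neq0 : fa != 0.
Proof. by rewrite (ff_poly_pull S_cone) pullX polyX_eq0. Qed.

(** The equation [u^N = c / a] of the cone. *)
Lemma cone_relation : (fb / fa) ^+ N = fc / fa.
Proof.
pose p : {mpoly C[3]} := 'X_coord_b ^+ N * 'X_coord_a.
pose q : {mpoly C[3]} := 'X_coord_c * 'X_coord_a ^+ N.
have /subr0_eq pq : ff_poly S p - ff_poly S q = 0.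
  apply/eqP; rewrite -ff_polyB (ff_poly_pull S_cone) pullB !pullM !pullXn !pullX.
  by rewrite /cone_coord /= subr_eq0 exprMn mulrC mulrA mulrAC.
apply/eqP; rewrite expr_div_n eqr_div ?expf_neq0 ?fa_neq0 //.
by move: pq; rewrite /p /q !ff_polyM !ff_polyXn => ->.
Qed.

Lemma determinedMn (x : funfield S) k : determined x -> determined (x *+ k).
Proof.
move=> xd u /xd[v xv]; exists (k%:R * v) => phi phiu.
rewrite -[x *+ k]mulr_natl; apply: (@pl_mul _ _ _ phi); last exact: xv.
by rewrite -(rmorph_nat (@ff_poly C 3 S \o @mpolyC 3 C)); apply: pl_const.
Qed.

(** The function is [t u^k].  Where a does not vanish it is regular.  Where a
    vanishes, [(t u^k)^N = a^(N-k) c^k] forces the value 0 for k < N, and for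
    k = N the function is c itself. *)
Lemma slope_determined k : (k <= N)%N -> determined (fa * (fb / fa) ^+ k).
Proof.
move=> kN s Ss; set x := fa * _.
have [sa|sa] := eqVneq (s coord_a) 0; last first.
  pose p : {mpoly C[3]} := 'X_coord_a * 'X_coord_b ^+ k.
  pose q : {mpoly C[3]} := 'X_coord_a ^+ k.
  have q0 : q.@[s] != 0 by rewrite rmorphXn /= mevalXU expf_neq0.
  exists (p.@[s] / q.@[s]) => phi phis.
  rewrite -(place_fraction Ss phis p q0); congr (phi _).
  by rewrite /x expr_div_n mulrA /p /q ff_polyM !ff_polyXn.
have [kE|kE] := eqVneq k N.
  exists (s coord_c) => phi phis; rewrite /x kE cone_relation mulrC divfK ?fa_neq0 //.
  by rewrite (place_poly Ss phis) mevalXU.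
exists 0 => phi phis.
apply: (place_pow_eq0 (k := N) (y := ff_poly S ('X_coord_a ^+ (N - k) * 'X_coord_c ^+ k))).
- exact: N_gt0.
- rewrite exprMn exprAC cone_relation ff_polyM !ff_polyXn expr_div_n mulrCA.
  by rewrite [RHS]mulrC expfB // ltn_neqAle kE.
rewrite (place_poly Ss phis) mevalM !rmorphXn /= !mevalXU sa expr0n subn_eq0 leqNgt.
by rewrite ltn_neqAle kE kN /= mul0r.
Qed.

Lemma root_poly_parametric : is_parametric rp.
Proof.
split=> [|k]; first by rewrite root_poly_size.
rewrite root_poly_coef; case: leqP => kN; first exact/determinedMn/slope_determined.
move=> u Su; exists (k == N.+1)%:R => phi _.
by rewrite -(rmorph_nat (@ff_poly C 3 S \o @mpolyC 3 C)); apply: pl_const.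
Qed.

(** If [t] and [u] are nonzero, a multiple root y of [Y^(N+1) + t (1 + u Y)^N]
    satisfies [u y = - (N + 1)]; substituting this back makes the third
    expression vanish. *)
Definition good_param (tu : C * C) : bool :=
  [&& tu.1 != 0, tu.2 != 0 &
      tu.1 * tu.2 ^+ N.+1 * (- N%:R) ^+ N + (- N.+1%:R) ^+ N.+1 != 0].

Definition good_point := {tu : C * C | good_param tu}.

Definition at_good (i : good_point) : {mpoly C[3]} -> C :=
  meval (cone_point n (sval i).1 (sval i).2).
HB.instance Definition _ i := GRing.RMorphism.on (at_good i).

Lemma good_kernel i p : ff_poly S p = 0 -> at_good i p = 0.
Proof.
move/ff_poly_eq0; apply; rewrite S_cone; apply: sub_zclosure.
by case: i => [[t u] /= /and3P[t0 _ _]]; exists t, u.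
Qed.

(** The condition on good parameters is a nonvanishing polynomial in t and u, and
    a product of nonzero polynomials is nonzero at some point. *)
Lemma good_dense p : ff_poly S p != 0 -> exists i, at_good i p != 0.
Proof.
rewrite (ff_poly_pull S_cone) => p0.
pose E : {poly {poly C}} :=
  'X * 'X%:P ^+ N.+1 * ((- N%:R) ^+ N)%:P%:P + ((- N.+1%:R) ^+ N.+1)%:P%:P.
have EE t u : eval2 t u E = t * u ^+ N.+1 * (- N%:R) ^+ N + (- N.+1%:R) ^+ N.+1.
  by rewrite /eval2 /= /horner_eval /E !(hornerE, horner_exp).
pose D := 'X * 'X%:P * E.
have D3 t u : eval2 t u D =
    t * u * (t * u ^+ N.+1 * (- N%:R) ^+ N + (- N.+1%:R) ^+ N.+1).
  by rewrite -EE /eval2 /= /horner_eval /D !(hornerE, horner_exp).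
have D0 : D != 0.
  rewrite !mulf_neq0 ?polyX_eq0 ?polyC_eq0 ?polyX_eq0 //.
  apply: contra_eq_neq (EE 0 0) => ->.
  by rewrite rmorph0 !mul0r add0r eq_sym expf_neq0 // oppr_eq0 pnatr_eq0.
apply: contrapT => nex; suff /eqP : pull n p * D = 0.
  by rewrite mulf_eq0 (negPf p0) (negPf D0).
apply: poly2_eq0 => t u; rewrite (rmorphM (eval2 t u)) [X in _ * X](D3 t u).
apply/eqP/negPn/negP; rewrite !mulf_eq0 -!orbA => /norP[pt /norP[t0 /norP[u0 d0]]].
have gtu : good_param (t, u) by rewrite /good_param /= t0 u0.
apply: nex; exists (exist _ (t, u) gtu).
by rewrite /at_good /= -pull_eval.
Qed.

Local Notation spec i := (specializes (@ff_poly C 3 S) (at_good i)).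

Definition root_poly_at (t u : C) : {poly C} := 'X ^+ N.+1 + t%:P * (1 + u%:P * 'X) ^+ N.

Lemma root_poly_atE t u y : (root_poly_at t u).[y] = y ^+ N.+1 + t * (1 + u * y) ^+ N.
Proof. by rewrite /root_poly_at !(hornerE, horner_exp). Qed.

Lemma root_poly_specializes i : spec i rp (root_poly_at (sval i).1 (sval i).2).
Proof.
have ker := @good_kernel i.
rewrite /root_poly /root_poly_at -!mul_polyC.
have ta : local_value (@ff_poly C 3 S) (at_good i) fa (sval i).1.
  have <- : at_good i 'X_coord_a = (sval i).1 by rewrite /at_good mevalXU.
  exact: local_value_j.
have tu : local_value (@ff_poly C 3 S) (at_good i) (fb / fa) (sval i).2.
  have atX l : at_good i 'X_l = cone_point n (sval i).1 (sval i).2 l.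
    by rewrite /at_good mevalXU.
  have /and3P[t0 _ _] := valP i.
  exists 'X_coord_b, 'X_coord_a; split=> //; first by rewrite [X in X != 0]atX.
  by rewrite [X in _ = X / _]atX [X in _ = _ / X]atX /cone_point /= mulrAC divff // mul1r.
apply: (specializesD ker); first exact: (specializesXn ker) (specializesX _ _).
apply: (specializesM ker); first exact: specializesC.
apply: (specializesXn ker); apply: (specializesD ker).
  exact: specializesC (local_value1 _ _).
by apply: (specializesM ker); [exact: specializesC | exact: specializesX].
Qed.

Lemma induced_specializes i (B : {mpoly rat[4]}) :
  exists B', spec i (induced S B) B' /\ forall x : aff C 4,
    forget_last x = cone_point n (sval i).1 (sval i).2 ->
    B'.[x ord_max] = mmap ratr x B.
Proof.
have ker := @good_kernel i.
pose h (l : 'I_4) : {poly C} :=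
  if unlift ord_max l is Some l' then (cone_point n (sval i).1 (sval i).2 l')%:P else 'X.
exists (mmap (fun c => (ratr c)%:P) h B); split.
  rewrite /induced /mmap; elim/big_rec2: _ => [|m P' P _ PP'].
    by apply: specializesC (local_value0 _ _).
  apply: (specializesD ker) => //; apply: (specializesM ker).
    apply: specializesC; rewrite ff_poly_ratr.
    have aE : at_good i (ratr B@_m)%:MP = ratr B@_m by rewrite /at_good mevalC.
    rewrite -[X in local_value _ _ _ X]aE.
    exact: local_value_j.
  rewrite /mmap1; elim/big_rec2: _ => [|l Q' Q _ QQ'].
    by apply: specializesC (local_value1 _ _).
  apply: (specializesM ker) => //; apply: (specializesXn ker); rewrite /h.
  case: unliftP => [l' _|_]; last exact: specializesX.
  apply: specializesC.
  have <- : at_good i 'X_l' = cone_point n (sval i).1 (sval i).2 l'.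
    by rewrite /at_good mevalXU.
  exact: local_value_j.
move=> x xE; rewrite -[LHS]/(horner_eval _ _) rmorph_mmap; apply: eq_mmap => [c|l] /=.
  by rewrite /horner_eval hornerC.
rewrite /horner_eval /h; case: unliftP => [l' ->|->]; last by rewrite hornerX.
by rewrite hornerC -xE.
Qed.

End RootPolynomial.

(** * The root polynomial and the gcd of the family *)

Section RootGcd.

Variables (C : numClosedFieldType) (n : nat) (S : irrset C 3).
Hypothesis S_cone : irr_set S = @cone_closure C n.
Local Notation N := (2 ^ n)%N.
Local Notation rp := (root_poly n S).
Local Notation spec i := (specializes (@ff_poly C 3 S) (at_good i)).

Lemma good_common_root (d h : {poly funfield S}) bs :
  (1 < size d)%N -> all (fun b => d %| b) bs -> coprimep d h ->
  exists (i : good_point C n) y h', [/\ spec i h h', h'.[y] != 0 &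
    forall b, b \in bs -> exists b', spec i b b' /\ root b' y].
Proof.
exact: (@common_root_at_point _ _ C _ (@ff_poly C 3 S) (fun i => @at_good C n i)
  (@ff_fraction C 3 S) (good_kernel S_cone) (good_dense S_cone)).
Qed.

(** A common factor with the derivative would specialize to a multiple root at
    some good parameter. *)
Lemma root_poly_separable : coprimep rp rp^`().
Proof.
have rp0 : rp != 0 by rewrite -size_poly_gt0 root_poly_size.
apply/negPn/negP; rewrite /coprimep => g1.
have gt1 : (1 < size (gcdp rp rp^`()))%N.
  have : gcdp rp rp^`() != 0 by rewrite gcdp_eq0 (negPf rp0).
  by rewrite -size_poly_gt0; case: size g1 => [|[]].
have := good_common_root (h := 1) (bs := [:: rp; rp^`()]) gt1.
rewrite /= dvdp_gcdl dvdp_gcdr coprimep1 => /(_ isT isT)[i [y [_ [_ _ ry]]]].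
have [|c [rc cy]] := ry rp; first by rewrite inE eqxx.
have [|c' [rc' cy']] := ry rp^`(); first by rewrite !inE eqxx orbT.
have ker := good_kernel S_cone i.
have sp := root_poly_specializes S_cone i.
move/(specializes_uniq ker rc): (sp) => cE.
move/(specializes_uniq ker rc'): (specializes_deriv sp) => c'E.
move: cy cy'; rewrite cE c'E {cE c'E c c' rc rc' ry sp ker}.
case: i => -[t u] /= /and3P[/= t0 u0 disc].
rewrite /root root_poly_atE => /eqP y0.
have -> : (root_poly_at n t u)^`() =
    N.+1%:R *: 'X^N + (t * (N%:R * u))%:P * (1 + u%:P * 'X) ^+ N.-1.
  rewrite /root_poly_at derivD derivXn derivM derivC mul0r add0r deriv_exp derivD derivM.
  rewrite -polyC1 !derivC derivX mul0r mulr1 !add0r scaler_nat; congr (_ + _).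
  by rewrite -mulr_natl !polyCM polyC_natr; ring.
rewrite !(hornerE, horner_exp) => /eqP y1'.
have y1 : N.+1%:R * y ^+ N + t * (N%:R * u) * (1 + u * y) ^+ N.-1 = 0.
  by rewrite -[RHS]y1' /=; ring.
have N0 : (0 < N)%N := N_gt0 n.
have yN0 : y != 0.
  apply: contra_eq_neq y0 => ->.
  by rewrite expr0n /= add0r mulr0 addr0 expr1n mulr1.
have powN : (1 + u * y) ^+ N = (1 + u * y) ^+ N.-1 * (1 + u * y).
  by rewrite -exprSr prednK.
(* Eliminating t from the polynomial and its derivative leaves a polynomial
   whose only nonzero root is y = - (N + 1) / u. *)
have uyE : N.+1%:R + u * y = 0.
  have : y ^+ N * (N.+1%:R + u * y) = 0.
    have -> : y ^+ N * (N.+1%:R + u * y) =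
        (N.+1%:R * y ^+ N + t * (N%:R * u) * (1 + u * y) ^+ N.-1) * (1 + u * y) -
        N%:R * u * (y ^+ N.+1 + t * (1 + u * y) ^+ N).
      by rewrite powN exprS -[N.+1%:R]natr1; ring.
    by rewrite y0 y1 mul0r mulr0 subr0.
  by move/eqP; rewrite mulf_eq0 expf_eq0 (negPf yN0) andbF => /eqP.
have {}uyE : u * y = - N.+1%:R by apply/eqP; rewrite -addr_eq0 addrC uyE.
move/eqP: disc; apply.
have -> : t * u ^+ N.+1 * (- N%:R) ^+ N + (- N.+1%:R) ^+ N.+1 =
    u ^+ N.+1 * (y ^+ N.+1 + t * (1 + u * y) ^+ N).
  rewrite mulrDr -exprMn uyE.
  have -> : 1 - N.+1%:R = - N%:R :> C by rewrite -natr1; ring.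
  by rewrite addrC; congr (_ + _); ring.
by rewrite y0 mulr0.
Qed.

Lemma root_poly_squarefree (d : {poly funfield S}) : d ^+ 2 %| rp -> (size d <= 1)%N.
Proof.
move=> /dvdpP[q rpE].
have dg : d %| gcdp rp rp^`().
  rewrite dvdp_gcd; apply/andP; split; first by rewrite rpE expr2 mulrA dvdp_mull.
  rewrite rpE expr2 mulrA derivM dvdp_add //; first exact: dvdp_mull.
  by apply: dvdp_mulr; apply: dvdp_mull.
have /eqP g1 := root_poly_separable.
by have := dvdp_leq _ dg; rewrite -size_poly_gt0 g1; apply.
Qed.

Variable Bs : seq {mpoly rat[4]}.
Hypothesis BsE : system_set C Bs = zclosure (@incidence n C).

Lemma incidence_at (i : good_point C n) y :
  root (root_poly_at n (sval i).1 (sval i).2) y ->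
  exists2 x : aff C 4, incidence n x &
    x ord_max = y /\ forget_last x = cone_point n (sval i).1 (sval i).2.
Proof.
move=> ry; have xm := extend_point_last (cone_point n (sval i).1 (sval i).2) y.
have xf := forget_extend_point (cone_point n (sval i).1 (sval i).2) y.
exists (extend_point (cone_point n (sval i).1 (sval i).2) y) => //.
exists (sval i).1, (sval i).2; split=> //.
  by have /and3P[] := valP i.
by rewrite /root_relation xm -root_poly_atE; apply/eqP.
Qed.

(** The cofactor of the gcd with the induced polynomial is coprime to the latter
    because the root polynomial is squarefree.  If it were not constant, it would
    give a point of the incidence set at which B does not vanish. *)
Lemma root_poly_dvd B : B \in Bs -> rp %| induced S B.
Proof.
move=> BBs; set b := induced S B.
have rp0 : rp != 0 by rewrite -size_poly_gt0 root_poly_size.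
pose e := gcdp rp b; pose d := rp %/ e.
have rpE : rp = d * e by rewrite divpK // dvdp_gcdl.
have d0 : d != 0 by apply: contraNneq rp0; rewrite rpE => ->; rewrite mul0r.
have db : coprimep d b.
  pose w := gcdp d b.
  have wd : w %| d := dvdp_gcdl _ _.
  have w2 : w ^+ 2 %| rp.
    rewrite rpE expr2 dvdp_mul // dvdp_gcd dvdp_gcdr andbT.
    by rewrite rpE; apply: dvdp_trans wd (dvdp_mulr _ _).
  have w0 : w != 0 by rewrite gcdp_eq0 (negPf d0).
  have := root_poly_squarefree w2; rewrite /coprimep -/w leq_eqVlt => /orP[//|].
  by rewrite ltnS leqn0 size_poly_eq0 (negPf w0).
have [d1|d1] := leqP (size d) 1; last first.
  have [|i [y [b' [bb' b'y ry]]]] := good_common_root (bs := [:: rp]) d1 _ db.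
    by rewrite /= andbT rpE dvdp_mulr.
  have [|c [rc cy]] := ry rp; first by rewrite inE.
  have ker := good_kernel S_cone i.
  rewrite (specializes_uniq ker rc (root_poly_specializes S_cone i)) in cy.
  have [x xW [xm xf]] := incidence_at cy.
  have [B' [BB' /(_ _ xf)]] := induced_specializes S_cone i B.
  rewrite (specializes_uniq ker BB' bb') xm => b'E.
  have : system_set C Bs x by rewrite BsE; apply: sub_zclosure.
  by move=> /(_ _ BBs); rewrite -b'E => /eqP; rewrite (negPf b'y).
have := size1_polyC d1 => dE.
have c0 : d`_0 != 0 by apply: contraNneq d0 => c0; rewrite dE c0 polyC0.
by rewrite rpE dE mul_polyC dvdpZl // dvdp_gcdr.
Qed.

(** The equation of the incidence set is polynomial in a, b, y after
    multiplication by [a^N], hence it persists on the closure. *)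
Lemma system_point x : system_set C Bs x -> forall t u, t != 0 ->
  forget_last x = cone_point n t u -> root_relation n t u (x ord_max).
Proof.
rewrite BsE => /zclosureP xV t u t0 xf.
pose X i : {mpoly C[4]} := 'X_(lift ord_max i).
pose Y : {mpoly C[4]} := 'X_ord_max.
pose H := X coord_a ^+ N * Y ^+ N.+1 + X coord_a * (X coord_a + X coord_b * Y) ^+ N.
have HE z s v : forget_last z = cone_point n s v ->
    H.@[z] = s ^+ N * (z ord_max ^+ N.+1 + s * (1 + v * z ord_max) ^+ N).
  move=> zf; have zi l : z (lift ord_max l) = cone_point n s v l by rewrite -zf.
  rewrite /H mevalD !mevalM !rmorphXn /= mevalD mevalM !mevalXU !zi /cone_point /=.
  have -> : s + s * v * z ord_max = s * (1 + v * z ord_max) by ring.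
  by rewrite exprMn; ring.
have := xV H; rewrite (HE _ _ _ xf) => h.
have /eqP : t ^+ N * (x ord_max ^+ N.+1 + t * (1 + u * x ord_max) ^+ N) = 0.
  apply: h => z [s [v [s0 rz zf]]]; rewrite (HE _ _ _ zf).
  by rewrite [X in _ * X](rz) mulr0.
by rewrite mulf_eq0 expf_eq0 (negPf t0) andbF => /eqP.
Qed.

(** A root of d at a good parameter is a common zero of the whole system, hence
    a point of the closure of the incidence set. *)
Lemma common_divisor_not_coprime (d : {poly funfield S}) :
  (1 < size d)%N -> (forall B, B \in Bs -> d %| induced S B) -> ~~ coprimep d rp.
Proof.
move=> d1 dB; apply/negP => drp.
have [|i [y [c [rc cy By]]]] := good_common_root (bs := map (induced S) Bs) d1 _ drp.
  by apply/allP => _ /mapP[B BBs ->]; apply: dB.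
have ker := good_kernel S_cone i.
move: cy; rewrite (specializes_uniq ker rc (root_poly_specializes S_cone i)).
have xm := extend_point_last (cone_point n (sval i).1 (sval i).2) y.
have xf := forget_extend_point (cone_point n (sval i).1 (sval i).2) y.
have /and3P[t0 _ _] := valP i.
rewrite root_poly_atE -{1 2}xm => /eqP; apply; apply: (system_point _ t0 xf) => B BBs.
have [b' [bb' b'y]] := By _ (map_f _ BBs).
have [B' [BB' /(_ _ xf) <-]] := induced_specializes S_cone i B.
by apply/eqP; rewrite (specializes_uniq ker BB' bb') xm.
Qed.

Lemma root_poly_at0 : ~~ root rp 0.
Proof.
rewrite /root horner_coef0 root_poly_coef /= expr0 mulr1 bin0 mulr1n.
exact: fa_neq0 S_cone.
Qed.

Lemma induced_neq0 : exists2 B, B \in Bs & induced S B != 0.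
Proof.
apply: contrapT => all0.
(* If all induced polynomials were 0, the polynomial X, which is coprime to the
   root polynomial, would divide them. *)
have : ~~ coprimep ('X : {poly funfield S}) rp.
  apply: common_divisor_not_coprime => [|B BBs]; first by rewrite size_polyX.
  have [->|B0] := eqVneq (induced S B) 0; first exact: dvdp0.
  by case: all0; exists B.
by rewrite coprimep_sym -['X]subr0 -polyC0 coprimep_XsubC root_poly_at0.
Qed.

(** The part of h coprime to the root polynomial still divides the system, so it
    is constant. *)
Lemma same_zeroes_gcd (h : {poly funfield S}) : h != 0 -> rp %| h ->
  (forall B, B \in Bs -> h %| induced S B) -> same_zeroes rp h.
Proof.
move=> h0 rph hB L iota y; apply/idP/idP; apply/implyP.
  move: rph; rewrite -(dvdp_map iota) => rph.
  by apply/implyP => ry; apply: root_dvdp ry.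
(* gdcop rp h is the largest divisor of h that is coprime to rp; its roots are
   the roots of h that are not roots of rp. *)
have gh : gdcop rp h %| h := dvdp_gdco _ _.
have g1 : (size (gdcop rp h) <= 1)%N.
  rewrite leqNgt; apply/negP => g1.
  have := common_divisor_not_coprime g1 (fun B BBs => dvdp_trans gh (hB B BBs)).
  by rewrite coprimep_gdco.
apply/implyP => hy; apply: contraTT g1 => ry.
rewrite -ltnNge -(size_map_poly iota) gdcop_map; apply: (@root_size_gt1 _ y).
  rewrite -gdcop_map map_poly_eq0.
  by apply: contraNneq h0 => g0; move: gh; rewrite g0 dvd0p.
by rewrite root_gdco ?map_poly_eq0 // hy.
Qed.

End RootGcd.

(** * The algebraic family, growth, and the theorem *)

Section Family.

Variables (C : numClosedFieldType) (n : nat).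
Local Notation N := (2 ^ n)%N.

Lemma root_relation_solvable (t u : C) : exists y, root_relation n t u y.
Proof.
have /closed_rootP[y] : size (root_poly_at n t u) != 1%N.
  rewrite /root_poly_at size_polyDl size_polyXn // ltnS mul_polyC.
  apply: leq_trans (size_scale_leq _ _) _; apply: leq_trans (size_poly_exp_leq _ _) _.
  rewrite ltnS -[leqRHS]mul1n leq_mul2r -subn1 leq_subLR; apply/orP; right.
  rewrite (leq_trans (size_polyD _ _)) // geq_max size_poly1 mul_polyC.
  by rewrite (leq_trans (size_scale_leq _ _)) // size_polyX.
by rewrite /root root_poly_atE => /eqP ry; exists y.
Qed.

(** Over every point of the parametrization there is a root, since C is
    algebraically closed. *)
Lemma forget_incidence :
  [set forget_last x | x in @incidence n C]%classic = @cone_points C n.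
Proof.
apply/seteqP; split=> [_ [x [t [u [t0 _ xf]]] <-]|_ [t [u [t0 ->]]]]; first by exists t, u.
have [y ry] := root_relation_solvable t u.
have xf := forget_extend_point (cone_point n t u) y.
exists (extend_point (cone_point n t u) y) => //; exists t, u; split=> //.
by rewrite extend_point_last.
Qed.

Lemma forget_last_pullback (p : {mpoly C[3]}) (x : aff C 4) :
  (mmap (@mpolyC 4 C) (fun i => 'X_(lift ord_max i)) p).@[x] = p.@[forget_last x].
Proof.
rewrite [LHS]rmorph_mmap; apply: eq_mmap => [c|i] /=; first by rewrite mevalC.
by rewrite mevalXU.
Qed.

Variable Bs : seq {mpoly rat[4]}.
Hypothesis BsE : system_set C Bs = zclosure (@incidence n C).

Lemma param_closure_cone : @param_closure C 3 Bs = @cone_closure C n.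
Proof.
rewrite /param_closure BsE /cone_closure -forget_incidence.
exact: (zclosure_image (@incidence n C) forget_last_pullback).
Qed.

Lemma induced_rational (r : nat) (S : irrset C r) B :
  induced S B \is a polyOver (@ff_rational C r S).
Proof.
apply: rpred_sum => m _; apply: rpredM; first by rewrite polyOverC rpred_rat.
apply: rpred_prod => i _; apply: rpredX.
case: unlift => [l|]; last exact: polyOverX.
by rewrite polyOverC ff_rationalX.
Qed.

(** The monic gcd h of the family is not known explicitly, as the system may
    have multiplicities; only its divisors and its zeroes matter. *)
Lemma root_poly_gsq (A : alg_family C Bs) :
  is_gsq_param_gcd A (root_poly n (param_space A)).
Proof.
set S := param_space A; set rp := root_poly n S.
have S_cone : irr_set S = @cone_closure C n by rewrite -param_closure_cone.
have fam b : b \in family_polys A -> exists2 B, B \in Bs & b = induced S B.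
  by rewrite mem_filter => /andP[_ /mapP].
have [||h [hm hk hd hu]] := @monic_gcd_exists _ (@ff_rational C 3 S) (family_polys A).
- by apply/allP => b /fam[B _ ->]; apply: induced_rational.
- have [B BBs B0] := induced_neq0 S_cone BsE.
  by apply/hasP; exists (induced S B) => //; rewrite mem_filter B0 map_f.
have hB B : B \in Bs -> h %| induced S B.
  move=> BBs; have [->|B0] := eqVneq (induced S B) 0; first exact: dvdp0.
  by apply: (allP hd); rewrite mem_filter B0 map_f.
exists h; split; first by split=> // d _; apply: hu.
split.
- exact: root_poly_monic.
- exact: root_poly_rational.
- by move=> d _; apply: root_poly_squarefree.
- apply: (same_zeroes_gcd S_cone BsE) => //; first exact: monic_neq0.
  by apply: hu; apply/allP => b /fam[B BBs ->]; apply: (root_poly_dvd S_cone BsE).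
exact: root_poly_parametric.
Qed.

Lemma family_exists : 0 \notin Bs -> alg_family C Bs.
Proof.
move=> nz; have irr : zirreducible (@param_closure C 3 Bs).
  by rewrite param_closure_cone; apply: cone_irreducible.
apply: (@AlgFamily C 3 Bs nz _ irr).
  have [y ry] := root_relation_solvable 1 0.
  have : cone_points n (cone_point n 1 (0 : C)) by exists 1, 0; rewrite oner_eq0.
  rewrite -forget_incidence => -[x xi _]; exists x.
  by rewrite BsE; apply: sub_zclosure.
have [|B BBs B0] := @induced_neq0 C n (IrrSet irr) _ Bs BsE.
  exact: param_closure_cone.
by apply/hasP; exists B.
Qed.

End Family.

Section Growth.

(** One constant for both the factor and the exponent makes the property stable
    under composition without tracking degrees. *)
Definition poly_bounded (f : nat -> nat) := exists K, forall l, (f l <= K * l.+1 ^ K)%N.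

Lemma poly_bounded_horner (f : nat -> nat) (p : {poly nat}) :
  (forall l, (f l <= p.[l]%R)%N) -> poly_bounded f.
Proof.
move=> fp; pose c i := nth 0%N (polyseq p) i.
exists (\sum_(i < size p) c i + size p)%N => l; apply: leq_trans (fp l) _.
have -> : p.[l]%R = (\sum_(i < size p) c i * l ^ i)%N.
  have powE k : (l ^+ k)%R = (l ^ k)%N by elim: k => // k IHk; rewrite exprS IHk expnS.
  by rewrite horner_coef; apply: eq_bigr => i _; rewrite powE.
apply: (@leq_trans ((\sum_(i < size p) c i) * l.+1 ^ size p)).
  rewrite big_distrl; apply: leq_sum => i _; rewrite leq_mul2l; apply/orP; right.
  apply: (@leq_trans (l.+1 ^ i)); last by rewrite leq_pexp2l // ltnW.
  by case: (nat_of_ord i) => [|k]; rewrite ?expn0 // leq_exp2r.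
by rewrite leq_mul ?leq_addr // leq_pexp2l // leq_addl.
Qed.

Lemma poly_bounded_comp f g :
  poly_bounded f -> poly_bounded g -> poly_bounded (fun l => f (g l)).
Proof.
move=> [K fK] [K' gK']; pose M := (K * K'.+1 ^ K + K' * K)%N.
exists M => l; apply: leq_trans (fK _) _.
have g1 : ((g l).+1 <= K'.+1 * l.+1 ^ K')%N.
  by rewrite mulSn -add1n leq_add // expn_gt0.
apply: (@leq_trans (K * K'.+1 ^ K * l.+1 ^ (K' * K))).
  rewrite -mulnA leq_mul2l; apply/orP; right.
  rewrite expnM -expnMn; case: {fK M} K => [|K]; first by rewrite !expn0.
  by rewrite leq_exp2r.
by rewrite leq_mul ?leq_addr // leq_pexp2l // leq_addl.
Qed.

Lemma exp2_not_poly_bounded : ~ poly_bounded (fun n => 2 ^ n)%N.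
Proof.
move=> [K bK].
(* The exponential beats the bound at the argument 2 ^ (2 * K) - 1. *)
have big : (K * (2 * K).+1 < 2 ^ (2 * K))%N.
  elim: K {bK} => // K IHK; rewrite [(2 * K.+1)%N]mulnS expnD.
  have -> : (2 ^ 2 = 4)%N by [].
  nia.
have := bK (2 ^ (2 * K)).-1; rewrite prednK ?expn_gt0 // -expnM.
apply/negP; rewrite -ltnNge.
apply: (@leq_trans (2 ^ K * 2 ^ (2 * K * K))).
  by rewrite ltn_pmul2r ?expn_gt0 // ltn_expl.
by rewrite -expnD leq_pexp2l // -ltnS prednK ?expn_gt0 //; apply: leq_trans big; nia.
Qed.

End Growth.

Theorem theorem4 (R : realType) (rep : input_representation)
    (D : output_structure R[i]) (P : elimination_procedure rep D)
    (T : nat -> nat) (T_mono : {homo T : a b / (a <= b)%N})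
    (elimP : forall (n : nat) (Phi : ex_formula rep n),
       out_set (ep_elim P Phi) = ex_set R[i] Phi /\
       (out_length (ep_elim P Phi) <= T (ex_length Phi))%N)
    (closureP : forall (n : nat) (Xi : out_formula D n),
       system_set R[i] (system_polys (ep_closure P Xi)) = zclosure (out_set Xi) /\
       (system_length (ep_closure P Xi) <= T (out_length Xi))%N)
    (gcdP : forall (r : nat) (B : system D r.+1)
         (A : alg_family R[i] (system_polys B)) (exA : has_gsq_param_gcd A)
         (hh : {poly funfield (param_space A)}),
       is_gsq_param_gcd A hh ->
       computes (ep_gcd P exA) hh /\
       (ga_size (ep_gcd P exA) <= T (system_length B))%N) :
  ~ (exists p : {poly nat}, forall l : nat, (T l <= p.[l]%R)%N).
Proof.
move=> [p Tp]; have Tb := poly_bounded_horner Tp.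
apply: exp2_not_poly_bounded.
suff [K bK] : poly_bounded (fun n => T (T (T (400 * n.+1)%N))).
  exists K => n; apply: leq_trans (bK n).
  have [Phi [PhiE Phi_len]] := incidence_formula rep n R[i].
  have [XiE Xi_len] := elimP _ Phi; set Xi := ep_elim P Phi in XiE Xi_len.
  have [FE F_len] := closureP _ Xi; set F := ep_closure P Xi in FE F_len.
  (* An algebraic family consists of nonzero polynomials; dropping the zero
     polynomials changes neither the zero set nor the bound on the length. *)
  pose B : system D 4 := [seq f <- F | en_poly f != 0].
  have BF : system_polys B = [seq q <- system_polys F | q != 0].
    by rewrite /system_polys filter_map.
  have BE : system_set R[i] (system_polys B) = zclosure (@incidence n R[i]).
    rewrite -PhiE -XiE -FE BF; apply/seteqP; split=> x h q.
      have [->|q0] := eqVneq q 0; first by rewrite mmap0.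
      by move=> qF; apply: h; rewrite mem_filter q0.
    by rewrite mem_filter => /andP[_ qF]; apply: h.
  have B0 : 0 \notin system_polys B by rewrite BF mem_filter eqxx.
  have B_len : (system_length B <= system_length F)%N.
    rewrite /system_length leq_add2l big_filter.
    by rewrite [leqRHS](bigID (fun f => en_poly f != 0)) leq_addr.
  have A := family_exists BE B0.
  have gsq := root_poly_gsq BE A.
  have exA : has_gsq_param_gcd A by eexists; exact: gsq.
  have [[_ _ gen val] G_len] := gcdP _ _ _ exA _ gsq.
  have S_cone : irr_set (param_space A) = @cone_closure R[i] n.
    exact: param_closure_cone BE.
  apply: leq_trans (ltnW (cone_code_size S_cone _ gen)) _.
    move=> i; have [|z [hu [zi _ _ _]]] := val (fun=> 0).
      by rewrite S_cone; apply: cone_origin.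
    by exists (z i).
  apply: leq_trans G_len _; apply/T_mono/(leq_trans B_len)/(leq_trans F_len)/T_mono.
  exact/(leq_trans Xi_len)/T_mono.
apply: poly_bounded_comp => //; apply: poly_bounded_comp => //.
apply: poly_bounded_comp => //; exists 400 => l.
by rewrite leq_mul2l /= -{1}(expn1 l.+1) leq_pexp2l.
Qed.
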